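(* Suppose the standing assumptions on $f,R,T$ and the inner approximation property stated in the context hold. Fix the initial point $w^0\in\operatorname{dom}\varphi$, the radii $0<\Delta_0\le\Delta_{\max}<\infty$, the algorithmic parameters, and a uniform bound $\|B_k\|\le b_{\max}<\infty$, all independently of $\varepsilon$. For every $0<\varepsilon\le1$, the trust-region method with relative gap tests (stated in the context), run with tolerance $\varepsilon$, terminates finitely and returns a point $w$ with $\chi(w)\le\varepsilon$. The number of outer trials is $O(\varepsilon^{-2})$ as $\varepsilon\downarrow0$, i.e. there are constants $C>0$ and $\varepsilon_0\in(0,1]$, independent of $\varepsilon$, such that for $0<\varepsilon\le\varepsilon_0$ the number of outer trials is at most $C\varepsilon^{-2}$. (This estimate does not count inner proximal iterations or applications of $T$ and $T^*$.)
   Context: $W$ is a real Hilbert space with inner product $(\cdot,\cdot)_W$; $X$ is a real Banach space with continuous dual $X^*$; $T:W\to X$ is bounded and linear with Banach adjoint $T^*:X^*\to W^*$. $\|\ell\|_{W^*}=\|\mathcal R_W^{-1}\ell\|_W$ with $\mathcal R_W:W\to W^*$ the Riesz map. Standing assumptions: $R:X\to(-\infty,+\infty]$ is proper, convex, norm lower semicontinuous; $\varphi=R\circ T$, $\operatorname{dom}\varphi\ne\emptyset$; $f:W\to\mathbb R$ is continuously Fréchet differentiable with Hilbert gradient $\nabla f$ (i.e. $(\nabla f(w),v)_W=f'(w)[v]$) globally Lipschitz with constant $L_f\ge0$; $F=f+\varphi$ is bounded below on $\operatorname{dom}\varphi$ by a finite $F_{\rm low}$. Fixed parameters: $\tau>0$,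 $0<\sigma<1$, $0<\zeta<1$, $0<\nu\le1$, $0<\eta_1<\eta_2<1$, $0<\gamma_c<1<\gamma_e$. $p(w;t)=\arg\min_{s\in W}\{(\nabla f(w),s)_W+\frac1{2t}\|s\|_W^2+\varphi(w+s)\}$ (unique), and $\chi(w)=\frac1\tau\|p(w;\tau)\|_W$. For $q\in W$, $t>0$: $\Psi_{q,t}(y)=\frac1{2t}\|y-q\|_W^2+R(Ty)$, $D_{q,t}(\mu)=\langle\mu,Tq\rangle-\frac t2\|T^*\mu\|_{W^*}^2-R^*(\mu)$, $R^*(\mu)=\sup_{x\in X}(\langle\mu,x\rangle-R(x))$, gap $\mathcal G_{q,t}(y,\mu)=\Psi_{q,t}(y)-D_{q,t}(\mu)$, finite when $Ty\in\operatorname{dom}R$, $\mu\in\operatorname{dom}R^*$. Inner approximation property: for every requested $w\in\operatorname{dom}\varphi$ and $t>0$, with $q=w-t\nabla f(w)$, the inner procedure produces a sequence of pairs $(y^j,\mu^j)\in W\times X^*$ with finite gaps and $\mathcal G_{q,t}(y^j,\mu^j)\to0$, together with available numbers $\overline{\mathcal G}_j\ge\mathcal G_{q,t}(y^j,\mu^j)$, $\overline{\mathcal G}_j\to0$, used in all tests ($\overline{\mathcal G}_j$ is either the gap itself or a rigorous upper bound for it). The pair $(s,\mu)=(y^j-w,\mu^j)$ passes the relative test at $(w,t)$ if $\overline{\mathcal G}_j\le\frac{\sigma^2}{2t}\|s\|_W^2$. Stationarity-test procedure at $w$ with tolerance $\varepsilon$: take $t=\tau$ and generate the pairs above. At each pair: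 (i) if $U_\tau(y^j,\mu^j;w):=\frac{\|y^j-w\|_W}{\tau}+\sqrt{2\overline{\mathcal G}_j/\tau}\le\varepsilon$, stop with a stationarity certificate; (ii) otherwise, if $(y^j-w,\mu^j)$ passes the relative test at $(w,\tau)$, stop with a relative certificate. Model: $B_k:W\to W$ bounded, self-adjoint; $m_k(s)=f(w^k)+(\nabla f(w^k),s)_W+\frac12(B_ks,s)_W+\varphi(w^k+s)$, $\operatorname{pred}_k(s)=m_k(0)-m_k(s)$. Geometric Cauchy search (at a point with $\chi(w^k)>0$): set $\bar t_k=\min\{\tau,(1-\sigma)/(1+\|B_k\|)\}$. For $j=0,1,\dots$ let $t_{k,j}=\zeta^j\bar t_k$, and run the inner procedure at $(w^k,t_{k,j})$ until a pair $(s_{k,j},\mu_{k,j})$ passes the relative test at $(w^k,t_{k,j})$. Return $s_k^{\rm C}=s_{k,j}$ for the first $j$ with $\|s_{k,j}\|_W\le\Delta_k$. Trust-region method with relative gap tests, tolerance $\varepsilon>0$: for $k=0,1,\dots$: 1. Apply the stationarity-test procedure at $w^k$. If it stops with a stationarity certificate, terminate and return $w^k$; otherwise continue. 2. Choose $B_k$, compute $s_k^{\rm C}$ by the geometric Cauchy search, and choose $d_k$ with $\|d_k\|_W\le\Delta_k$, $w^k+d_k\in\operatorname{dom}\varphi$, $\operatorname{pred}_k(d_k)\ge\nu\operatorname{pred}_k(s_k^{\rm C})$. 3. Compute $\rho_k=[F(w^k)-F(w^k+d_k)]/\operatorname{pred}_k(d_k)$. 4. If $\rho_k<\eta_1$: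 $w^{k+1}=w^k$, $\Delta_{k+1}=\gamma_c\Delta_k$. If $\eta_1\le\rho_k<\eta_2$: $w^{k+1}=w^k+d_k$, $\Delta_{k+1}=\Delta_k$. If $\rho_k\ge\eta_2$: $w^{k+1}=w^k+d_k$, $\Delta_{k+1}=\min\{\gamma_e\Delta_k,\Delta_{\max}\}$. An outer trial is one execution of steps 2–4 (accepted and rejected trials are both counted). Any optional search for an alternative trial step is stopped after finitely many iterations, with $d_k=s_k^{\rm C}$ used if no admissible alternative has been found. *)

(* Defs.v *)
From HB Require Import structures.
From mathcomp Require Import all_boot all_order all_algebra.
From mathcomp Require Import all_classical all_reals all_analysis.

Set Implicit Arguments.
Unset Strict Implicit.
Unset Printing Implicit Defensive.

Import Order.TTheory GRing.Theory Num.Theory.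
Import numFieldNormedType.Exports.

Local Open Scope classical_set_scope.
Local Open Scope ring_scope.

(* Real Hilbert spaces: complete normed spaces whose norm is induced by an
   inner product. *)
HB.mixin Record CompleteNormedModule_isHilbert (R : realType) W
    & CompleteNormedModule R W := {
  ip : W -> W -> R ;
  ipC : forall u v, ip u v = ip v u ;
  ip_linearl : forall a u v w, ip (a *: u + v) w = a * ip u w + ip v w ;
  ip_norm : forall u, ip u u = `|u| ^+ 2
}.

#[short(type="hilbertType")]
HB.structure Definition Hilbert (R : realType) :=
  {W of CompleteNormedModule R W & CompleteNormedModule_isHilbert R W}.

(* Boundedness is expressed by continuity; for linear maps the two coincide by
   linear_bounded_continuous. *)
Record bounded_linear (R : realType) (V W : normedModType R) := BoundedLinear {
  blin_fun :> {linear V -> W} ;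
  blin_continuous : continuous blin_fun
}.

Definition dual (R : realType) (V : normedModType R) := bounded_linear V R.

Section operators.
Context {R : realType}.

Definition adjoint (V W : normedModType R) (T : bounded_linear V W)
    (mu : dual W) : dual V :=
  @BoundedLinear R V R (blin_fun mu \o blin_fun T)
    (fun x => continuous_comp (@blin_continuous _ _ _ T x)
                              (@blin_continuous _ _ _ mu (T x))).

Definition opnorm (V W : normedModType R) (B : bounded_linear V W) : R :=
  sup [set `|B u| | u in [set u : V | `|u| <= 1]].

(* The inverse of the Riesz map u |-> (u, .)_W. *)
Definition riesz_inv (W : hilbertType R) (l : dual W) : W :=
  xget 0 [set u : W | forall v, ip u v = l v].

Definition dual_norm (W : hilbertType R) (l : dual W) : R := `|riesz_inv l|.

Definition self_adjoint (W : hilbertType R) (B : bounded_linear W W) :=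
  forall u v : W, ip (B u) v = ip u (B v).

Definition is_gradient (W : hilbertType R) (f : W -> R) (gradf : W -> W) :=
  forall w, differentiable f w /\ forall v, ip (gradf w) v = 'd f w v.

End operators.

Section extended_real_functions.
Context {R : realType} {V : normedModType R}.
Implicit Type g : V -> \bar R.
Local Open Scope ereal_scope.

Definition edom g : set V := [set x | g x < +oo].

Definition eproper g := (forall x, -oo < g x) /\ edom g !=set0.

Definition econvex g := forall x y (a : R), (0 < a < 1)%R ->
  g (a *: x + (1 - a) *: y)%R <= a%:E * g x + (1 - a)%:E * g y.

Definition conjugate g (mu : dual V) : \bar R :=
  ereal_sup (range (fun x => (mu x)%:E - g x)).

End extended_real_functions.

(* n is the first index satisfying P: where a search that tests the indices
   0, 1, 2, ... one after the other stops. *)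
Definition first_index (P : nat -> Prop) (n : nat) :=
  P n /\ forall i, (i < n)%N -> ~ P i.

Record tr_params (R : realType) := TRParams {
  tau : R ; sigma : R ; zeta : R ; nu : R ;
  eta1 : R ; eta2 : R ; gammac : R ; gammae : R
}.

Definition admissible_params (R : realType) (p : tr_params R) :=
  [/\ 0 < tau p, 0 < sigma p < 1, 0 < zeta p < 1 & 0 < nu p <= 1] /\
  [/\ 0 < eta1 p, eta1 p < eta2 p, eta2 p < 1, 0 < gammac p < 1
    & 1 < gammae p].

(* One output (y^j, mu^j) of the inner procedure, with the available number
   used in place of its gap in all tests. *)
Record inner_output (R : realType) (W X : normedModType R) := InnerOutput {
  out_y : W ;
  out_mu : dual X ;
  out_gap : R
}.

Section trust_region.
Context {R : realType} {W : hilbertType R} {X : completeNormedModType R}.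
Variables (T : bounded_linear W X) (reg : X -> \bar R).
Variables (f : W -> R) (gradf : W -> W).

Local Open Scope ereal_scope.

Definition phi (w : W) : \bar R := reg (T w).

Definition objective (w : W) : \bar R := (f w)%:E + phi w.

Definition prox_objective (w : W) (t : R) (s : W) : \bar R :=
  (ip (gradf w) s + (2 * t)^-1 * `|s| ^+ 2)%:E + phi (w + s)%R.

Definition prox_step (w : W) (t : R) : W :=
  xget (0 : W)%R
    [set s | forall s', prox_objective w t s <= prox_objective w t s'].

Definition chi (t : R) (w : W) : R := (t^-1 * `|prox_step w t|)%R.

Definition primal (q : W) (t : R) (y : W) : \bar R :=
  ((2 * t)^-1 * `|y - q| ^+ 2)%:E + reg (T y).

Definition dual_value (q : W) (t : R) (mu : dual X) : \bar R :=
  (mu (T q) - t / 2 * dual_norm (adjoint T mu) ^+ 2)%:E - conjugate reg mu.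

Definition gap (q : W) (t : R) (y : W) (mu : dual X) : \bar R :=
  primal q t y - dual_value q t mu.

Local Close Scope ereal_scope.

Definition inner_approximation (w : W) (t : R)
    (z : nat -> inner_output W X) :=
  let q := w - t *: gradf w in
  let G j := gap q t (out_y (z j)) (out_mu (z j)) in
  [/\ forall j, G j \is a fin_num, G @ \oo --> 0%E,
      forall j, (G j <= (out_gap (z j))%:E)%E
    & (fun j => out_gap (z j)) @ \oo --> (0 : R)].

(* An inner procedure is the relation "inner w t z": called at (w, t), it may
   produce the sequence z.  It need not be a function of (w, t), so that
   different calls may give different sequences. *)
Definition inner_approximation_property
    (inner : W -> R -> (nat -> inner_output W X) -> Prop) :=
  forall w t, edom phi w -> 0 < t ->
    (exists z, inner w t z) /\ forall z, inner w t z -> inner_approximation w t z.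

Variable p : tr_params R.

Definition relative_test (w : W) (t : R) (o : inner_output W X) :=
  out_gap o <= sigma p ^+ 2 / (2 * t) * `|out_y o - w| ^+ 2.

Definition stat_bound (w : W) (o : inner_output W X) : R :=
  `|out_y o - w| / tau p + Num.sqrt (2 * out_gap o / tau p).

Definition stat_test_stops (eps : R) (w : W) (z : nat -> inner_output W X)
    (j : nat) :=
  first_index
    (fun i => stat_bound w (z i) <= eps \/ relative_test w (tau p) (z i)) j.

Definition stat_certificate (eps : R) (w : W) (z : nat -> inner_output W X) :=
  exists2 j, stat_test_stops eps w z j & stat_bound w (z j) <= eps.

Definition relative_certificate (eps : R) (w : W)
    (z : nat -> inner_output W X) :=
  exists2 j, stat_test_stops eps w z j & eps < stat_bound w (z j).

Section trial.
Variables (w : W) (Delta : R) (B : bounded_linear W W).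

Local Open Scope ereal_scope.

Definition model (s : W) : \bar R :=
  (f w + ip (gradf w) s + 2^-1 * ip (B s) s)%:E + phi (w + s)%R.

Definition pred_decrease (s : W) : \bar R := model 0%R - model s.

Local Close Scope ereal_scope.

Definition cauchy_radius (j : nat) : R :=
  zeta p ^+ j * Num.min (tau p) ((1 - sigma p) / (1 + opnorm B)).

(* The step kept from the inner sequence z produced at (w, t). *)
Definition inner_pass (t : R) (z : nat -> inner_output W X) (s : W) :=
  exists2 n, first_index (fun i => relative_test w t (z i)) n &
             s = out_y (z n) - w.

(* The geometric Cauchy search returns sC when z j is the sequence produced by
   the inner procedure at (w, cauchy_radius j). *)
Definition cauchy_search (z : nat -> nat -> inner_output W X) (sC : W) :=
  exists (s : nat -> W) (j : nat),
    [/\ forall i, (i <= j)%N -> inner_pass (cauchy_radius i) (z i) (s i),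
        first_index (fun i => `|s i| <= Delta) j
      & sC = s j].

Definition admissible_step (sC d : W) :=
  [/\ `|d| <= Delta, edom phi (w + d)
    & ((nu p)%:E * pred_decrease sC <= pred_decrease d)%E].

Definition ratio (d : W) : R :=
  fine (objective w - objective (w + d)%R)%E / fine (pred_decrease d).

Definition next_state (Dmax : R) (d : W) : W * R :=
  if ratio d < eta1 p then (w, gammac p * Delta)
  else if ratio d < eta2 p then (w + d, Delta)
  else (w + d, Num.min (gammae p * Delta) Dmax).

End trial.

Variable inner : W -> R -> (nat -> inner_output W X) -> Prop.
Variables (bmax Dmax : R).

Definition model_operator (B : bounded_linear W W) :=
  self_adjoint B /\ opnorm B <= bmax.

(* From (w, Delta), the stationarity test at w does not certify stationarity
   and the ensuing outer trial leads to (w', Delta'). *)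
Definition outer_trial (eps : R) (w : W) (Delta : R) (w' : W) (Delta' : R) :=
  (exists2 z, inner w (tau p) z & relative_certificate eps w z) /\
  exists (B : bounded_linear W W) (z : nat -> nat -> inner_output W X)
      (sC d : W),
    [/\ model_operator B, forall j, inner w (cauchy_radius B j) (z j),
        cauchy_search w Delta B z sC, admissible_step w Delta B sC d
      & (w', Delta') = next_state w Delta B Dmax d].

Definition returns (eps : R) (w : W) :=
  exists2 z, inner w (tau p) z & stat_certificate eps w z.

(* All the computations of the iteration started at (w, Delta) stop, whatever
   the inner procedure produces and whatever B is chosen: the stationarity test
   stops; after a relative certificate, the geometric Cauchy search may be
   called, each of its inner runs stops, and so does the search itself.  Its
   result is an admissible trial step, hence an available fallback for any
   search for an alternative. *)
Definition iteration_stops (eps : R) (w : W) (Delta : R) :=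
  [/\ edom phi w,
      forall z, inner w (tau p) z -> exists j, stat_test_stops eps w z j
    & forall z, inner w (tau p) z -> relative_certificate eps w z ->
      0 < chi (tau p) w /\
      forall (B : bounded_linear W W) (zC : nat -> nat -> inner_output W X),
        model_operator B -> (forall j, inner w (cauchy_radius B j) (zC j)) ->
        exists2 sC, cauchy_search w Delta B zC sC &
                    admissible_step w Delta B sC sC].

Variables (w0 : W) (Delta0 : R).

(* w and Delta record an execution from (w0, Delta0) with tolerance eps whose
   first n outer trials are completed; their values after n are irrelevant. *)
Definition run (eps : R) (n : nat) (w : nat -> W) (Delta : nat -> R) :=
  [/\ w 0%N = w0, Delta 0%N = Delta0
    & forall k, (k < n)%N ->
        outer_trial eps (w k) (Delta k) (w k.+1) (Delta k.+1)].

(* No execution gets stuck inside an iteration, and none performs infinitely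
   many outer trials: every execution reaches a stationarity certificate. *)
Definition terminates_finitely (eps : R) :=
  (forall n w Delta, run eps n w Delta -> iteration_stops eps (w n) (Delta n))
  /\ ~ exists w Delta, forall n, run eps n w Delta.

End trust_region.

(* Main.v *)
Require Import Defs.
From mathcomp Require Import all_boot all_order all_algebra.
From mathcomp Require Import all_classical all_reals all_analysis.
From mathcomp Require Import ring lra.

Set Implicit Arguments.
Unset Strict Implicit.
Unset Printing Implicit Defensive.

Import Order.TTheory GRing.Theory Num.Theory.
Import numFieldNormedType.Exports.

Local Open Scope classical_set_scope.
Local Open Scope ring_scope.

(** The proof compares every computed step with the exact proximal step p of the
    same radius t.

    Duality.  By weak duality the primal value of an inner pair exceeds the minimum
    of the primal function by at most the gap G (primal_le_gap).  That function is
    strongly convex with modulus 1 / t, so the minimizer exists (proximal_point,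
    prox_stepP; a finite dual value bounds the function from below) and the computed
    step s satisfies |s - p|^2 <= 2 t G (approx_prox_dist).  Weak duality involves
    the dual norm through the Riesz representer, whose existence is another instance
    of proximal_point (riesz_invP).  At radius tau the distance estimate gives
    chi <= U, which makes a stationarity certificate sound (chi_le_stat_bound), and
    a relative certificate with U > eps gives
    chi > (1 - sigma) / (1 + sigma) * eps (relative_certificate_chi).

    Sufficient decrease.  If s passes the relative test, then |s| and |p| are
    comparable and the linearized model decreases by (1 - sigma) |s|^2 / t; the cap
    on the radii leaves at least half of this in the quadratic model
    (inner_pass_decrease).  Since |p| / t is nonincreasing in t, |s| is at least of
    order t * chi.  If the search has backtracked, the preceding step, whose radius
    is larger by the factor 1 / zeta, was longer than Delta, so |s| is at least of
    order Delta.  Hence the decrease is at least a constant times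
    chi * min (chi, Delta) (cauchy_search_decrease).  The search stops because
    |p| tends to 0 with t (step_sqr_le).

    Counting.  The model error is O(Delta^2), so a trial with Delta <= kappa * eps is
    very successful (outer_trial_dichotomy) and all radii stay above a multiple of
    eps (run_invariant).  An accepted trial therefore lowers the objective by a
    multiple of eps^2.  A rejected trial does not, but it multiplies the radius by
    gammac < 1.  A weighted sum of the objective and of ln Delta decreases by at
    least 1 in every trial (run_potential), and it can decrease by O(eps^-2) only:
    the objective is bounded below and ln Delta >= ln eps - O(1).  The same bound
    excludes infinite executions. *)

(** * Hilbert space geometry *)

Lemma eq_ler (R : numDomainType) (x y : R) : x = y -> x <= y.
Proof. by move=> ->. Qed.

Section hilbert_algebra.
Context {R : realType} {W : hilbertType R}.
Implicit Types (u v w x y q : W) (a b : R).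

Lemma ipDl u v w : ip (u + v) w = ip u w + ip v w.
Proof. by rewrite -{1}[u]scale1r ip_linearl mul1r. Qed.

Lemma ip0l u : ip 0 u = 0.
Proof. by apply: (@addrI _ (ip 0 u)); rewrite -ipDl !addr0. Qed.

Lemma ipZl a u w : ip (a *: u) w = a * ip u w.
Proof. by rewrite -[a *: u]addr0 ip_linearl ip0l addr0. Qed.

Lemma ipDr u v w : ip w (u + v) = ip w u + ip w v.
Proof. by rewrite ![ip w _]ipC ipDl. Qed.

Lemma ipZr a u w : ip w (a *: u) = a * ip w u.
Proof. by rewrite ![ip w _]ipC ipZl. Qed.

Lemma ip0r u : ip u 0 = 0.
Proof. by rewrite ipC ip0l. Qed.

Lemma ipNl u w : ip (- u) w = - ip u w.
Proof. by rewrite -scaleN1r ipZl mulN1r. Qed.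

Lemma ipNr u w : ip w (- u) = - ip w u.
Proof. by rewrite ![ip w _]ipC ipNl. Qed.

Definition ipE := (ipDl, ipDr, ipNl, ipNr, ipZl, ipZr).

Lemma normD_sqr u v : `|u + v| ^+ 2 = `|u| ^+ 2 + 2 * ip u v + `|v| ^+ 2.
Proof. by rewrite -!ip_norm !ipE [ip v u]ipC; ring. Qed.

Lemma normB_sqr u v : `|u - v| ^+ 2 = `|u| ^+ 2 - 2 * ip u v + `|v| ^+ 2.
Proof. by rewrite normD_sqr normrN ipNr; ring. Qed.

Lemma ip_young a u v : 0 < a ->
  ip u v <= a / 2 * `|u| ^+ 2 + (2 * a)^-1 * `|v| ^+ 2.
Proof.
move=> a0; have : 0 <= (2 * a)^-1 * `|a *: u - v| ^+ 2.
  by rewrite mulr_ge0 ?sqr_ge0// invr_ge0 mulr_ge0// ltW.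
rewrite normB_sqr normrZ exprMn real_normK ?num_real// ipZl.
suff -> : (2 * a)^-1 * (a ^+ 2 * `|u| ^+ 2 - 2 * (a * ip u v) + `|v| ^+ 2)
  = a / 2 * `|u| ^+ 2 - ip u v + (2 * a)^-1 * `|v| ^+ 2 by lra.
by field; rewrite gt_eqF.
Qed.

Lemma ip_le_norm u v : ip u v <= `|u| * `|v|.
Proof.
have [->|u0] := eqVneq u 0; first by rewrite ip0l normr0 mul0r.
have [->|v0] := eqVneq v 0; first by rewrite ip0r normr0 mulr0.
have nu0 : `|u| != 0 by rewrite normr_eq0.
have nv0 : `|v| != 0 by rewrite normr_eq0.
(* The weight that makes the two squares in Young's inequality equal. *)
have a0 : 0 < `|v| / `|u| by rewrite divr_gt0// normr_gt0.
apply: (le_trans (ip_young u v a0)); apply: eq_ler.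
by field; rewrite nu0.
Qed.

Lemma normr_ip_le u v : `|ip u v| <= `|u| * `|v|.
Proof.
rewrite ler_norml ip_le_norm andbT lerNl -ipNl.
by apply: le_trans (ip_le_norm _ _) _; rewrite normrN.
Qed.

(** The strong convexity of the squared distance to q, in the form of an identity. *)
Lemma norm_convex_sqr r x y q :
  `|r *: x + (1 - r) *: y - q| ^+ 2 =
  r * `|x - q| ^+ 2 + (1 - r) * `|y - q| ^+ 2 - r * (1 - r) * `|x - y| ^+ 2.
Proof.
rewrite -!ip_norm !ipE [ip y x]ipC ![ip q _]ipC; ring.
Qed.

End hilbert_algebra.

Section operator_norm.
Context {R : realType}.

Lemma opnorm_has_sup (V W : normedModType R) (B : bounded_linear V W) :
  has_sup [set `|B u| | u in [set u : V | `|u| <= 1]].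
Proof.
split; first by exists `|B 0|; exists 0 => //=; rewrite normr0.
have /linear_boundedP := continuous_linear_bounded 0 (@blin_continuous _ _ _ B 0).
move=> [M [_ /(_ (Num.max 0 M + 1))]]; rewrite ltr_pwDr ?le_max ?lexx ?orbT//.
move=> /(_ isT) BM; exists (Num.max 0 M + 1) => _ [u /= u1 <-].
apply: le_trans (BM u) _; rewrite -[leRHS]mulr1; apply: ler_wpM2l => //.
by apply: addr_ge0 => //; rewrite le_max lexx.
Qed.

Lemma opnorm_ge0 (V W : normedModType R) (B : bounded_linear V W) : 0 <= opnorm B.
Proof.
have [_ ub] := opnorm_has_sup B.
apply: (@le_trans _ _ `|B 0|); first exact: normr_ge0.
by apply: ub_le_sup ub _ _; exists 0 => //=; rewrite normr0.
Qed.

Lemma le_opnorm (V W : normedModType R) (B : bounded_linear V W) u :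
  `|B u| <= opnorm B * `|u|.
Proof.
have [->|u0] := eqVneq u 0; first by rewrite linear0 !normr0 mulr0.
have [_ ub] := opnorm_has_sup B.
have nu0 : 0 < `|u| by rewrite normr_gt0.
rewrite -ler_pdivrMr//.
have -> : `|B u| / `|u| = `|B (`|u|^-1 *: u)|.
  by rewrite linearZ/= normrZ ger0_norm ?invr_ge0// mulrC.
apply: ub_le_sup ub _ _; exists (`|u|^-1 *: u) => //=.
by rewrite normrZ ger0_norm ?invr_ge0// mulVf// gt_eqF.
Qed.

Lemma quadratic_le_opnorm (W : hilbertType R) (B : bounded_linear W W) s :
  `|ip (B s) s| <= opnorm B * `|s| ^+ 2.
Proof.
apply: le_trans (normr_ip_le _ _) _.
by rewrite expr2 mulrA ler_wpM2r// le_opnorm.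
Qed.

End operator_norm.

(** * Proximal points *)

Section proximal_point.
Context {R : realType} {W : hilbertType R}.
Variables (g : W -> \bar R) (q : W) (c : R).
Hypotheses (c0 : 0 < c) (gconvex : econvex g) (gNy : forall x, (-oo < g x)%E).

Let J y := ((c * `|y - q| ^+ 2)%:E + g y)%E.

Lemma le_regularized y a :
  (J y <= a%:E)%E = (g y <= (a - c * `|y - q| ^+ 2)%:E)%E.
Proof.
by rewrite EFinB leeBrDr// /J addeC.
Qed.

Lemma regularized_strongly_convex x y a b r : 0 < r < 1 ->
  (J x <= a%:E -> J y <= b%:E ->
  J (r *: x + (1 - r) *: y)%R <=
    (r * a + (1 - r) * b - c * r * (1 - r) * `|x - y| ^+ 2)%:E)%E.
Proof.
move=> r01; rewrite !le_regularized => gx gy.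
apply: le_trans (gconvex _ _ r01) _.
case/andP: r01 => r0 r1; have r1' : 0 < 1 - r by lra.
apply: le_trans (leeD (lee_wpmul2l _ gx) (lee_wpmul2l _ gy)) _.
- by rewrite lee_fin ltW.
- by rewrite lee_fin ltW.
rewrite -!EFinM -EFinD lee_fin norm_convex_sqr.
by apply: eq_ler; ring.
Qed.

(** Moving from the minimizer y towards y' by a fraction r changes the value by at
    most r (J y' - J y) - c r (1 - r) |y' - y|^2, which therefore is nonnegative;
    divide by r and let r tend to 0. *)
Lemma minimizer_growth y a : J y = a%:E -> (forall y', a%:E <= J y')%E ->
  forall y', (J y + (c * `|y' - y| ^+ 2)%:E <= J y')%E.
Proof.
move=> Jy amin y'; rewrite Jy -EFinD.
have := amin y'; case Jy' : (J y') => [b||]; [|by move=> _; rewrite leey|by rewrite leeNy_eq].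
rewrite !lee_fin => ab; rewrite leNgt; apply/negP => ltb.
set K := c * `|y' - y| ^+ 2 in ltb.
have K0 : 0 < K by lra.
(* With this r, (1 - r) * K is the midpoint of b - a and K. *)
pose r := (K - (b - a)) / (2 * K).
have r0 : 0 < r by apply: divr_gt0; lra.
have r1 : r < 1 by rewrite ltr_pdivrMr; lra.
have r01 : 0 < r < 1 by rewrite r0.
have h1 : (J y' <= b%:E)%E by rewrite Jy'.
have h2 : (J y <= a%:E)%E by rewrite Jy.
have := le_trans (amin _) (regularized_strongly_convex r01 h1 h2).
rewrite lee_fin.
have -> : c * r * (1 - r) * `|y' - y| ^+ 2 = r * ((1 - r) * K) by rewrite /K; ring.
have -> : (1 - r) * K = (K + (b - a)) / 2 by rewrite /r; field; rewrite gt_eqF.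
move=> h; have : 0 <= r * ((b - a - K) / 2) by lra.
by rewrite pmulr_rge0//; lra.
Qed.

Hypothesis glsc : lower_semicontinuous g.

Lemma limit_of_minimizing (u : nat -> W) (y : W) (m : R) :
  u @ \oo --> y -> (forall n, (J (u n) <= (m + n.+1%:R^-1)%:E)%E) ->
  (J y <= m%:E)%E.
Proof.
move=> uy Ju; rewrite leNgt; apply/negP => mJ.
have {mJ} mg : ((m - c * `|y - q| ^+ 2)%:E < g y)%E.
  by rewrite ltNge -le_regularized -ltNge.
have [a ma ag] : exists2 a : R, m - c * `|y - q| ^+ 2 < a & (a%:E < g y)%E.
  move: mg (gNy y); case: (g y) => [b||]//.
    rewrite lte_fin => mb _; exists ((m - c * `|y - q| ^+ 2 + b) / 2); first by lra.
    by rewrite lte_fin; lra.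
  by move=> _ _; exists (m - c * `|y - q| ^+ 2 + 1); [lra|rewrite ltry].
pose d := a - (m - c * `|y - q| ^+ 2); have d0 : 0 < d / 2 by rewrite /d; lra.
have [V Vy gV] := glsc ag.
have cvgsq : (fun n => c * `|u n - q| ^+ 2) @ \oo --> c * `|y - q| ^+ 2.
  apply: cvgM; first exact: cvg_cst.
  rewrite expr2; under eq_fun do rewrite expr2.
  by apply: cvgM; apply: cvg_norm; apply: cvgB => //; exact: cvg_cst.
suff : \forall n \near \oo, False by case=> N _ /(_ N) /=; apply.
near=> n.
have h1 : (a%:E < g (u n))%E.
  by apply: gV; near: n; exact: (uy _ Vy).
have h2 : `|c * `|y - q| ^+ 2 - c * `|u n - q| ^+ 2| < d / 2.
  by near: n; exact: cvgr_dist_lt cvgsq _ d0.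
have h3 : n.+1%:R^-1 < d / 2.
  by near: n; exact: near_infty_natSinv_lt (PosNum d0).
have := Ju n; rewrite le_regularized => /(lt_le_trans h1).
rewrite lte_fin; move: h2; rewrite ltr_norml => /andP[_].
move: h3; rewrite /d; move: (n.+1%:R^-1) => e; lra.
Unshelve. all: by end_near. Qed.

(** The midpoint of two nearly minimal points cannot be below the lower bound m, so
    strong convexity forces the points to be close to each other. *)
Lemma minimizing_cvg (u : nat -> W) (m : R) :
  (forall y, m%:E <= J y)%E -> (forall n, (J (u n) <= (m + n.+1%:R^-1)%:E)%E) ->
  cvgn u.
Proof.
move=> mJ Ju; apply/cauchy_cvgP; apply: cauchy_exP => e e0.
have ce0 : 0 < c / 4 * e ^+ 2 by rewrite mulr_gt0 ?exprn_gt0// divr_gt0.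
have [N _ NP] := near_infty_natSinv_lt (PosNum ce0).
exists (u N); exists N => // n /= Nn; rewrite -ball_normE /=.
have hN : (J (u N) <= (m + N.+1%:R^-1)%:E)%E by [].
have hn : (J (u n) <= (m + N.+1%:R^-1)%:E)%E.
  apply: le_trans (Ju n) _; rewrite lee_fin lerD2l lef_pV2 ?posrE//.
  by rewrite ler_nat ltnS.
have half : 0 < (2^-1 : R) < 1 by apply/andP; split; lra.
have := le_trans (mJ _) (regularized_strongly_convex half hN hn).
have := NP N (leqnn N); rewrite /= lee_fin; move: (N.+1%:R^-1) => k h1 h2.
rewrite -(@ltr_pXn2r _ 2)// ?nnegrE ?(ltW e0)//.
by rewrite -(ltr_pM2l (x := c / 4)) ?divr_gt0//; lra.
Qed.

(** Strong convexity makes every minimizing sequence Cauchy, and lower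
    semicontinuity makes its limit a minimizer. *)
Lemma proximal_point x0 b : edom g x0 -> (forall y, b%:E <= J y)%E ->
  exists2 y, J y \is a fin_num &
    forall y', (J y + (c * `|y' - y| ^+ 2)%:E <= J y')%E.
Proof.
move=> gx0 bJ.
have infb : (b%:E <= ereal_inf (range J))%E.
  by apply: le_ereal_inf_tmp => _ [y _ <-].
have infx0 : (ereal_inf (range J) <= J x0)%E by apply: ereal_inf_lbound; exists x0.
have Jx0 : (J x0 < +oo)%E by rewrite /J lte_add_pinfty// ltry.
have finf : ereal_inf (range J) \is a fin_num.
  rewrite fin_numE; apply/andP; split; apply/eqP => E.
    by move: infb; rewrite E leeNy_eq.
  by move: (le_lt_trans infx0 Jx0); rewrite E.
pose m := fine (ereal_inf (range J)).
have mE : ereal_inf (range J) = m%:E by rewrite fineK.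
have mJ y : (m%:E <= J y)%E by rewrite -mE; apply: ereal_inf_lbound; exists y.
have /choice[u Ju] (n : nat) : exists y, (J y <= (m + n.+1%:R^-1)%:E)%E.
  have n0 : 0 < n.+1%:R^-1 :> R by rewrite invr_gt0 ltr0n.
  have [_ [y _ <-]] := lb_ereal_inf_adherent n0 finf.
  by rewrite mE -EFinD => /ltW Jy; exists y.
have ucvg := minimizing_cvg mJ Ju.
have Jm : J (lim (u @ \oo)) = m%:E.
  by apply/eqP; rewrite eq_le mJ andbT; exact: limit_of_minimizing ucvg Ju.
exists (lim (u @ \oo)); first by rewrite Jm.
exact: minimizer_growth Jm mJ.
Qed.

End proximal_point.

Section riesz.
Context {R : realType} {W : hilbertType R}.
Implicit Types (l : dual W).

(** The representer is the proximal point of the origin for the convex function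
    - l: the growth inequality there is an affine inequality in the competitor,
    hence an equality. *)
Lemma riesz_invP l v : ip (riesz_inv l) v = l v.
Proof.
suff [u lu] : exists u : W, forall v, ip u v = l v.
  by apply: (@xgetPex _ 0 [set u : W | forall v, ip u v = l v]); exists u.
pose g (y : W) := (- l y)%:E.
have gconv : econvex g.
  move=> x y r _; rewrite /g linearD !linearZ/= -!EFinM -EFinD lee_fin.
  by apply: eq_ler; rewrite /GRing.scale/=; ring.
have glsc : lower_semicontinuous g.
  move=> x a; rewrite /g lte_fin => ax.
  have cl : (fun y => - l y) @ x --> - l x by apply: cvgN; exact: blin_continuous.
  exists [set y | a < - l y]; last by move=> y /=; rewrite lte_fin.
  by apply: (cvgr_gt (- l x) cl).
have half : 0 < 2^-1 :> R by lra.
have g0 : edom g 0 by rewrite /edom /g /= ltry.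
have gNy x : (-oo < g x)%E by rewrite ltNyr.
have [|u Ju ugrowth] := @proximal_point _ _ g 0 2^-1 half gconv gNy glsc 0
  (- (opnorm l ^+ 2 / 2)) g0.
  move=> y; rewrite /g -EFinD lee_fin subr0.
  have := le_opnorm l y; have := ler_norm (l y); have := sqr_ge0 (`|y| - opnorm l).
  by rewrite sqrrB -mulr_natl; lra.
exists u => {}v.
have key k : 0 <= k * (ip u v - l v).
  have := ugrowth (u + k *: v); rewrite /g -!EFinD lee_fin !subr0 [u + _ - u]addrAC subrr add0r.
  rewrite normD_sqr linearD linearZ/= ipZr -[k *: l v]/(k * l v); lra.
by have := key 1; have := key (-1); lra.
Qed.

(** Young's inequality in duality form; it rests on the Riesz representer being a
    true representer, since the dual norm is the norm of riesz_inv l. *)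
Lemma dual_young l t v : 0 < t ->
  l v <= t / 2 * dual_norm l ^+ 2 + (2 * t)^-1 * `|v| ^+ 2.
Proof. by move=> t0; rewrite -riesz_invP; exact: ip_young. Qed.

End riesz.

Section descent.
Context {R : realType} {W : hilbertType R}.

(** The mean value theorem compares the increment of f with the gradient at a point
    of the segment. It yields Lf in place of the sharp constant Lf / 2, and a
    constant factor here changes only the constant of the final bound. *)
Lemma lipschitz_gradient_bound (f : W -> R) (gradf : W -> W) (Lf : R) w d :
  0 <= Lf -> is_gradient f gradf -> Lf.-lipschitz gradf ->
  `|f (w + d) - f w - ip (gradf w) d| <= Lf * `|d| ^+ 2.
Proof.
move=> Lf0 fgrad flip.
pose F (r : R) := f (w + r *: d).
have dF (r : R) : is_derive r (1 : R) F (ip (gradf (w + r *: d)) d).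
  have [df dfE] := fgrad (w + r *: d).
  pose line := (cst w : R -> W) + ( *:%R ^~ d : R -> W).
  have dline : is_diff r line (0 + *:%R ^~ d) by exact: is_diffD.
  have dF : differentiable F r by apply: (@differentiable_comp _ _ _ _ line f).
  apply: DeriveDef; first exact/derivable1_diffP.
  rewrite deriveE// (@diff_comp _ _ _ _ line f)//= dfE.
  by rewrite (@diff_val _ _ _ _ _ _ _ dline) /= add0r scale1r.
have Fcont : {within `[0, 1], continuous F}.
  by apply: derivable_within_continuous => x _; case: (dF x).
have [c] := @MVT R F _ 0 1 ltr01 (fun x _ => dF x) Fcont.
rewrite in_itv /= => /andP[c0 c1].
rewrite /F scale1r scale0r addr0 subr0 mulr1 => ->.
rewrite -ipNl -ipDl; apply: le_trans (normr_ip_le _ _) _.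
rewrite expr2 mulrA ler_wpM2r//.
have := flip (w + c *: d, w); rewrite /= => /(_ (conj I I)).
rewrite addrAC subrr add0r normrZ (gtr0_norm c0) => /le_trans; apply.
by rewrite ler_wpM2l// ler_piMl// ltW.
Qed.

End descent.

(** * Duality gaps certify approximate proximal steps *)

Section weak_duality.
Context {R : realType} {W : hilbertType R} {X : completeNormedModType R}.
Variables (T : bounded_linear W X) (reg : X -> \bar R).
Hypothesis reg_proper : eproper reg.

(** The Fenchel inequality for reg at T y and Young's inequality for the quadratic
    part; the terms in mu (T y) cancel. *)
Lemma dual_value_le_primal q (t : R) mu y : 0 < t ->
  (dual_value T reg q t mu <= primal T reg q t y)%E.
Proof.
move=> t0; rewrite /primal /dual_value.
have : ((mu (T y))%:E - reg (T y) <= conjugate reg mu)%E.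
  by apply: ereal_sup_ubound; exists (T y).
have := reg_proper.1 (T y); case: (reg (T y)) => [r||]//; last first.
  by move=> _ _; rewrite addey// leey.
move=> _; case: (conjugate reg mu) => [c||]//; last by move=> _; rewrite /= leNye.
rewrite -!EFinB -EFinD !lee_fin => cr.
have /= := dual_young (adjoint T mu) (q - y) t0.
rewrite !linearB/= -[y - q]opprB normrN; lra.
Qed.

(** A gap bound turns into near-optimality with no knowledge of the minimizer. *)
Lemma primal_le_gap q (t : R) y mu (G : R) y' : 0 < t ->
  gap T reg q t y mu \is a fin_num -> (gap T reg q t y mu <= G%:E)%E ->
  (primal T reg q t y <= primal T reg q t y' + G%:E)%E.
Proof.
move=> t0; rewrite /gap fin_numB => /andP[pfin dfin].
rewrite leeBlDr// addeC => /le_trans; apply.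
by rewrite leeD2r// dual_value_le_primal.
Qed.

End weak_duality.

Section prox.
Context {R : realType} {W : hilbertType R} {X : completeNormedModType R}.
Variables (T : bounded_linear W X) (reg : X -> \bar R) (gradf : W -> W).
Hypotheses (reg_proper : eproper reg) (reg_convex : econvex reg)
  (reg_lsc : lower_semicontinuous reg).

Local Notation phi := (phi T reg).

Lemma phi_convex : econvex phi.
Proof.
move=> x y a a01; rewrite /Defs.phi linearD !linearZ/=; exact: reg_convex.
Qed.

Lemma phi_gtNy x : (-oo < phi x)%E.
Proof. exact: reg_proper.1. Qed.

Lemma phi_lsc : lower_semicontinuous phi.
Proof.
move=> x a /reg_lsc[V TxV regV]; exists (T @^-1` V); last by move=> y /regV.
exact: (blin_continuous TxV).
Qed.

Lemma phi_fineK x : edom phi x -> (fine (phi x))%:E = phi x.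
Proof. by move=> xdom; rewrite fineK// fin_numE gt_eqF ?phi_gtNy// lt_eqF. Qed.

(** The trust-region model without its curvature term and without the constant
    f w. Adding |s|^2 / (2 t) gives the objective of the proximal step. *)
Definition linearized (w s : W) : R := ip (gradf w) s + fine (phi (w + s)).

(** Near-optimality with error G in the proximal problem: what remains of a pair
    and its gap once the dual variable is forgotten. *)
Definition approx_prox (w : W) (t : R) (s : W) (G : R) :=
  edom phi (w + s) /\ forall s', edom phi (w + s') ->
    linearized w s + (2 * t)^-1 * `|s| ^+ 2
    <= linearized w s' + (2 * t)^-1 * `|s'| ^+ 2 + G.

(** The optimality condition of the proximal step: - s / t is a subgradient of
    linearized w at s. *)
Definition is_prox (w : W) (t : R) (s : W) :=
  edom phi (w + s) /\ forall s', edom phi (w + s') ->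
    linearized w s + t^-1 * (`|s| ^+ 2 - ip s s') <= linearized w s'.

Lemma prox_objectiveE w (t : R) s : edom phi (w + s) ->
  prox_objective T reg gradf w t s =
  (linearized w s + (2 * t)^-1 * `|s| ^+ 2)%:E.
Proof.
by move=> sdom; rewrite /prox_objective -phi_fineK// -EFinD addrAC.
Qed.

(** Completing the square: the primal function with center w - t gradf w is the
    proximal objective up to a constant. *)
Lemma primal_prox_objective w (t : R) s : 0 < t ->
  primal T reg (w - t *: gradf w) t (w + s) =
  (prox_objective T reg gradf w t s + (t / 2 * `|gradf w| ^+ 2)%:E)%E.
Proof.
move=> t0; rewrite /primal /prox_objective addeAC -EFinD; congr (_%:E + _)%E.
have -> : w + s - (w - t *: gradf w) = s + t *: gradf w.
  by rewrite opprB addrCA [w + s]addrC addrK addrC.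
rewrite normD_sqr normrZ gtr0_norm// ipZr [ip s _]ipC.
by field; rewrite gt_eqF.
Qed.

Lemma inner_approx_prox w (t : R) z : 0 < t -> edom phi w ->
  inner_approximation T reg gradf w t z ->
  forall j, approx_prox w t (out_y (z j) - w) (out_gap (z j)).
Proof.
move=> t0 wdom [Gfin _ Gle _] j.
have sdom : edom phi (w + (out_y (z j) - w)).
  have := Gfin j; rewrite /gap fin_numB => /andP[+ _].
  rewrite /primal fin_numD => /andP[_].
  by rewrite addrC subrK /edom/= => /fin_numPlt/andP[_].
split=> // s' s'dom.
have := primal_le_gap reg_proper (w + s') t0 (Gfin j) (Gle j).
rewrite -{1}[out_y (z j)](subrK w) [_ - w + w]addrC !primal_prox_objective//.
by rewrite !prox_objectiveE// -!EFinD lee_fin; lra.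
Qed.

(** The proximal step exists because any finite dual value produced by the inner
    procedure bounds the objective from below. Its optimality condition is the
    growth inequality at the minimizer with the squares expanded. *)
Lemma prox_stepP w (t : R) z : 0 < t -> edom phi w ->
  inner_approximation T reg gradf w t z ->
  is_prox w t (prox_step T reg gradf w t).
Proof.
move=> t0 wdom [Gfin _ _ _].
have c0 : 0 < (2 * t)^-1 by rewrite invr_gt0 mulr_gt0.
set q := w - t *: gradf w in Gfin.
have dfin : dual_value T reg q t (out_mu (z 0%N)) \is a fin_num.
  by have := Gfin 0%N; rewrite /gap fin_numB => /andP[].
have bounded y : ((fine (dual_value T reg q t (out_mu (z 0%N))))%:E
    <= primal T reg q t y)%E.
  by rewrite fineK//; exact: dual_value_le_primal.
have [y yfin ygrowth] := proximal_point c0 phi_convex phi_gtNy phi_lsc wdom bounded.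
have yE : y = w + (y - w) by rewrite addrC subrK.
have dom0 : edom phi (w + (y - w)).
  move: yfin; rewrite fin_numD => /andP[_].
  by rewrite -yE /edom/= => /fin_numPlt/andP[_].
have ymin s' : (prox_objective T reg gradf w t (y - w)%R
    + ((2 * t)^-1 * `|s' - (y - w)| ^+ 2)%:E <= prox_objective T reg gradf w t s')%E.
  have := ygrowth (w + s').
  rewrite -![(_ + phi _)%E]/(primal T reg q t _).
  rewrite {1}yE !primal_prox_objective// addeAC leeD2rE//.
  have -> : w + s' - y = s' - (y - w) by rewrite opprB addrA [s' + w]addrC.
  by [].
have [s smin sE] : exists2 s, (forall s', prox_objective T reg gradf w t s
    <= prox_objective T reg gradf w t s')%E & s = prox_step T reg gradf w t.
  exists (prox_step T reg gradf w t) => //.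
  apply: (@xgetPex _ 0 [set s | forall s', prox_objective T reg gradf w t s
     <= prox_objective T reg gradf w t s']%E).
  exists (y - w) => s'; apply: le_trans (ymin s').
  by rewrite leeDl// lee_fin mulr_ge0// ltW.
rewrite -sE; have {sE} -> : s = y - w.
  have := le_trans (ymin s) (smin (y - w)).
  rewrite prox_objectiveE// -EFinD lee_fin gerDl => h.
  have {}h : `|s - (y - w)| ^+ 2 <= 0 by rewrite -(pmulr_rle0 _ c0).
  apply/eqP; rewrite -subr_eq0 -normr_eq0 -sqrf_eq0 eq_le h sqr_ge0//.
split=> // s' s'dom; have := ymin s'.
rewrite !prox_objectiveE// -EFinD lee_fin [`|s' - _| ^+ 2]normB_sqr [ip s' _]ipC.
have -> : t^-1 * (`|y - w| ^+ 2 - ip (y - w) s') =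
   (2 * t)^-1 * (2 * (`|y - w| ^+ 2 - ip (y - w) s')) by field; rewrite gt_eqF.
by lra.
Qed.

Section prox_facts.
Variable w : W.
Implicit Types (s p : W) (t G : R).

(** The growth of the proximal objective around its minimizer p, evaluated at s. *)
Lemma approx_prox_dist t s p G : 0 < t -> is_prox w t p -> approx_prox w t s G ->
  `|s - p| ^+ 2 <= 2 * t * G.
Proof.
move=> t0 [pdom pP] [sdom sP]; have := pP _ sdom; have := sP _ pdom.
rewrite -ler_pdivrMl ?mulr_gt0// normB_sqr [ip s p]ipC.
have -> : t^-1 * (`|p| ^+ 2 - ip p s) = (2 * t)^-1 * (2 * (`|p| ^+ 2 - ip p s)).
  by field; rewrite gt_eqF.
by lra.
Qed.

(** Monotonicity of the subdifferential, tested with the two proximal steps, gives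
    (t' |p| - t |p'|) (|p| - |p'|) <= 0, whose two factors would have the same
    strict sign if either conclusion failed. *)
Lemma prox_step_monotone t t' p p' : 0 < t -> t <= t' ->
  is_prox w t p -> is_prox w t' p' ->
  t * `|p'| <= t' * `|p| /\ `|p| <= `|p'|.
Proof.
move=> t0 tt' [pdom pP] [p'dom p'P].
have t'0 : 0 < t' by lra.
have := pP _ p'dom; have := p'P _ pdom; have := ip_le_norm p p'.
rewrite [ip p' p]ipC => pp' h1 h2.
have h3 : t * (`|p'| ^+ 2 - ip p p') + t' * (`|p| ^+ 2 - ip p p') <= 0.
  have : 0 <= t * t' * (0 - (t^-1 * (`|p| ^+ 2 - ip p p') +
         t'^-1 * (`|p'| ^+ 2 - ip p p'))) by apply: mulr_ge0; [rewrite mulr_ge0// ltW|lra].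
  set e := (X in 0 <= X -> _).
  suff -> : e = - (t * (`|p'| ^+ 2 - ip p p') + t' * (`|p| ^+ 2 - ip p p')) by lra.
  by rewrite /e; field; rewrite !gt_eqF.
have h4 : (t' * `|p| - t * `|p'|) * (`|p| - `|p'|) <= 0.
  have : 0 <= (t + t') * (`|p| * `|p'| - ip p p') by apply: mulr_ge0; lra.
  by rewrite !expr2 in h3; nra.
have P0 := normr_ge0 p; have Q0 := normr_ge0 p'.
split; rewrite leNgt; apply/negP => lt.
- have : `|p| < `|p'| by nra.
  by nra.
- have : t * `|p'| < t' * `|p| by nra.
  by nra.
Qed.

(** The zero step is a competitor for p, whose objective is within G of that of s. *)
Lemma approx_prox_decrease t s p G : edom phi w -> 0 < t ->
  is_prox w t p -> approx_prox w t s G ->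
  (2 * t)^-1 * (`|s| ^+ 2 + `|p| ^+ 2) - G <= linearized w 0 - linearized w s.
Proof.
move=> wdom t0 [pdom pP] [sdom sP].
have := pP 0; rewrite addr0 ip0r => /(_ wdom); have := sP _ pdom.
have -> : t^-1 * (`|p| ^+ 2 - 0) = (2 * t)^-1 * (2 * `|p| ^+ 2).
  by field; rewrite gt_eqF.
by lra.
Qed.

(** The test bounds the distance from s to the exact step p by sg |s|. *)
Lemma relative_prox_norm t s p G sg : 0 < t -> 0 < sg < 1 ->
  is_prox w t p -> approx_prox w t s G -> G <= sg ^+ 2 / (2 * t) * `|s| ^+ 2 ->
  (1 - sg) * `|s| <= `|p| <= (1 + sg) * `|s|.
Proof.
move=> t0 /andP[sg0 sg1] pP sP Gs.
have : `|s - p| <= sg * `|s|.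
  rewrite -(@ler_pXn2r _ 2)// ?nnegrE ?mulr_ge0 ?(ltW sg0)//.
  apply: le_trans (approx_prox_dist t0 pP sP) _.
  rewrite exprMn -ler_pdivlMl ?mulr_gt0//; apply: le_trans Gs _.
  by rewrite mulrAC mulrC.
have := ler_distD 0 s p; have := lerB_dist s p; have := lerB_dist p s.
rewrite [`|p - s|]distrC; move=> h1 h2 _ h3; apply/andP; split; lra.
Qed.

(** The coefficient is 1 + (1 - sg)^2 - sg^2 = 2 (1 - sg), divided by 2 t: the two
    squares of the decrease estimate minus the admitted error. *)
Lemma relative_prox_decrease t s p G sg : edom phi w -> 0 < t -> 0 < sg < 1 ->
  is_prox w t p -> approx_prox w t s G -> G <= sg ^+ 2 / (2 * t) * `|s| ^+ 2 ->
  (1 - sg) / t * `|s| ^+ 2 <= linearized w 0 - linearized w s.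
Proof.
move=> wdom t0 sg01 pP sP Gs.
apply: le_trans (approx_prox_decrease wdom t0 pP sP).
have /andP[ps _] := relative_prox_norm t0 sg01 pP sP Gs.
have {}ps : ((1 - sg) * `|s|) ^+ 2 <= `|p| ^+ 2.
  by rewrite ler_pXn2r ?nnegrE// mulr_ge0//; lra.
apply: (@le_trans _ _ ((2 * t)^-1 * (`|s| ^+ 2 + ((1 - sg) * `|s|) ^+ 2)
   - sg ^+ 2 / (2 * t) * `|s| ^+ 2)).
  apply: eq_ler; field; rewrite gt_eqF//.
apply: lerB => //; rewrite ler_wpM2l ?lerD2l//.
by rewrite invr_ge0 mulr_ge0// ltW.
Qed.

End prox_facts.

End prox.

(** * The stationarity test *)

Lemma first_index_ex (P : nat -> Prop) : (exists n, P n) ->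
  exists n, first_index P n.
Proof.
move=> [n Pn]; have ex : exists n, `[< P n >] by exists n; exact/asboolP.
case: (ex_minnP ex) => m /asboolP Pm mmin; exists m; split=> // i im Pi.
by have := mmin i; rewrite leqNgt im => /(_ (introT (asboolP _) Pi)).
Qed.

Section iteration.
Context {R : realType} {W : hilbertType R} {X : completeNormedModType R}.
Variables (T : bounded_linear W X) (reg : X -> \bar R).
Variables (f : W -> R) (gradf : W -> W) (p : tr_params R).
Hypotheses (reg_proper : eproper reg) (reg_convex : econvex reg)
  (reg_lsc : lower_semicontinuous reg) (p_admissible : admissible_params p).

Local Notation phi := (phi T reg).
Local Notation approx_prox := (approx_prox T reg gradf).
Local Notation is_prox := (is_prox T reg gradf).
Local Notation linearized := (linearized T reg gradf).
Local Notation inner_approximation := (inner_approximation T reg gradf).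
Local Notation chi := (chi T reg gradf (tau p)).
Local Notation prox_step := (prox_step T reg gradf).

Let tau_gt0 : 0 < tau p. Proof. by case: p_admissible => [[]]. Qed.
Let sigma_gt0 : 0 < sigma p. Proof. by case: p_admissible => [[_ /andP[]]]. Qed.
Let sigma_lt1 : sigma p < 1. Proof. by case: p_admissible => [[_ /andP[]]]. Qed.
Let sigma01 : 0 < sigma p < 1. Proof. by rewrite sigma_gt0. Qed.
Let zeta_gt0 : 0 < zeta p. Proof. by case: p_admissible => [[_ _ /andP[]]]. Qed.
Let zeta_lt1 : zeta p < 1. Proof. by case: p_admissible => [[_ _ /andP[]]]. Qed.

Lemma inner_gap_lt w t z e : inner_approximation w t z -> 0 < e ->
  exists n, out_gap (z n) < e.
Proof.
move=> [_ _ _ gap0] e0; have [N _ NP] := cvgr_lt _ gap0 _ e0.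
by exists N; exact: NP (leqnn N).
Qed.

(** If the exact step q is nonzero, the computed steps stay away from zero while
    the gaps tend to zero. *)
Lemma relative_test_reached w (t : R) z : 0 < t -> edom phi w ->
  inner_approximation w t z -> prox_step w t != 0 ->
  exists n, relative_test p w t (z n).
Proof.
move=> t0 wdom zP p0; have pP := prox_stepP reg_proper reg_convex reg_lsc t0 wdom zP.
set q := prox_step w t in p0 pP *.
have q0 : 0 < `|q| by rewrite normr_gt0.
have s1 : 0 < 1 + sigma p by have := sigma_gt0; lra.
(* An error r in the step gives |s| >= |q| - r, hence r <= sigma |s|. *)
pose r := sigma p / (1 + sigma p) * `|q|.
have r0 : 0 < r by rewrite mulr_gt0// divr_gt0.
have e0 : 0 < r ^+ 2 / (2 * t) by rewrite divr_gt0 ?exprn_gt0// mulr_gt0.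
have [n nP] := inner_gap_lt zP e0; exists n.
have sP := inner_approx_prox reg_proper t0 wdom zP n.
have := approx_prox_dist t0 pP sP; rewrite /relative_test.
set s := out_y (z n) - w => d.
have t20 : 0 < 2 * t by rewrite mulr_gt0.
have sq : `|s - q| <= r.
  rewrite -(@ler_pXn2r _ 2)// ?nnegrE ?(ltW r0)//; apply: le_trans d _.
  by rewrite -ler_pdivlMl// mulrC ltW.
have rs : r <= sigma p * `|s|.
  have h : `|q| <= `|s| + r.
    have := lerB_dist q s; rewrite distrC; lra.
  have E : (1 + sigma p) * r = sigma p * `|q| by rewrite /r; field; rewrite gt_eqF.
  have : sigma p * `|q| <= sigma p * (`|s| + r) by rewrite ler_pM2l.
  by rewrite -E; lra.
apply: le_trans (ltW nP) _.
have : r ^+ 2 <= (sigma p * `|s|) ^+ 2.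
  by rewrite ler_pXn2r ?nnegrE ?(ltW r0)// mulr_ge0// ltW.
by move=> h; rewrite [leRHS]mulrAC -exprMn; apply: ler_wpM2r => //; rewrite invr_ge0 ltW.
Qed.

(** The distance from s to the exact step is at most sqrt (2 tau G), which after
    division by tau is the second term of the bound. *)
Lemma chi_le_stat_bound w z n : edom phi w -> inner_approximation w (tau p) z ->
  chi w <= stat_bound p w (z n).
Proof.
move=> wdom zP; have pP := prox_stepP reg_proper reg_convex reg_lsc tau_gt0 wdom zP.
have sP := inner_approx_prox reg_proper tau_gt0 wdom zP n.
have := approx_prox_dist tau_gt0 pP sP; rewrite /stat_bound /Defs.chi.
set s := out_y (z n) - w; set q := prox_step _ _; set G := out_gap _ => d.
have h : `|s - q| / tau p <= Num.sqrt (2 * G / tau p).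
  rewrite -[leLHS]ger0_norm; last by rewrite divr_ge0// ltW.
  rewrite -sqrtr_sqr; apply: ler_wsqrtr; rewrite expr_div_n.
  rewrite ler_pdivrMr ?exprn_gt0//; apply: le_trans d _.
  by apply: eq_ler; field; rewrite gt_eqF.
rewrite mulrC -lerBlDl; apply: le_trans h; rewrite -mulrBl ler_pM2r ?invr_gt0//.
by rewrite [`|s - q|]distrC lerB_dist.
Qed.

(** At a stationary point the iterates converge to w, so the stationarity bound tends
    to zero; elsewhere the relative test is eventually passed. *)
Lemma stat_test_stops_ex w z (eps : R) : 0 < eps -> edom phi w ->
  inner_approximation w (tau p) z -> exists j, stat_test_stops p eps w z j.
Proof.
move=> eps0 wdom zP; apply: first_index_ex.
have [q0|q0] := eqVneq (prox_step w (tau p)) 0; last first.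
  by have [n nP] := relative_test_reached tau_gt0 wdom zP q0; exists n; right.
(* A gap below tau eps^2 / 8 makes each of the two terms at most eps / 2. *)
have e0 : 0 < tau p * eps ^+ 2 / 8 by rewrite divr_gt0// mulr_gt0// exprn_gt0.
have [n nP] := inner_gap_lt zP e0; exists n; left.
have pP := prox_stepP reg_proper reg_convex reg_lsc tau_gt0 wdom zP.
have sP := inner_approx_prox reg_proper tau_gt0 wdom zP n.
have := approx_prox_dist tau_gt0 pP sP; rewrite /stat_bound q0 subr0.
set s := out_y (z n) - w; set G := out_gap _ in nP *; move=> d.
have h : 2 * tau p * G <= (tau p * (eps / 2)) ^+ 2.
  have -> : (tau p * (eps / 2)) ^+ 2 = 2 * tau p * (tau p * eps ^+ 2 / 8) by field.
  by rewrite ler_pM2l ?mulr_gt0// ltW.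
have h1 : `|s| / tau p <= eps / 2.
  rewrite ler_pdivrMr// mulrC -(@ler_pXn2r _ 2)// ?nnegrE ?mulr_ge0
    ?divr_ge0 ?(ltW eps0) ?(ltW tau_gt0)//.
  exact: le_trans d h.
have h2 : Num.sqrt (2 * G / tau p) <= eps / 2.
  rewrite -[leRHS]ger0_norm ?divr_ge0 ?(ltW eps0)// -sqrtr_sqr; apply: ler_wsqrtr.
  rewrite ler_pdivrMr//; have : 2 * G <= 2 * (tau p * eps ^+ 2 / 8) by lra.
  by move=> /le_trans; apply; apply: eq_ler; field.
lra.
Qed.

(** A pair that passes the relative test has stationarity bound at most
    (1 + sigma) / (1 - sigma) times chi; so a relative certificate, for which
    that bound exceeds the tolerance, keeps chi of the order of eps. *)
Lemma relative_certificate_chi w z (eps : R) : edom phi w ->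
  inner_approximation w (tau p) z -> relative_certificate p eps w z ->
  (1 - sigma p) / (1 + sigma p) * eps < chi w.
Proof.
move=> wdom zP [n [nP _] epsU].
have rel : relative_test p w (tau p) (z n).
  by case: nP => // /le_lt_trans/(_ epsU); rewrite ltxx.
have pP := prox_stepP reg_proper reg_convex reg_lsc tau_gt0 wdom zP.
have sP := inner_approx_prox reg_proper tau_gt0 wdom zP n.
have /andP[+ _] := relative_prox_norm tau_gt0 sigma01 pP sP rel.
move: epsU rel; rewrite /stat_bound /relative_test /Defs.chi.
set s := out_y (z n) - w; set q := prox_step _ _; set G := out_gap _.
move=> epsU rel sq.
have h : Num.sqrt (2 * G / tau p) <= sigma p * `|s| / tau p.
  rewrite -[leRHS]ger0_norm; last by rewrite divr_ge0 ?mulr_ge0// ltW.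
  rewrite -sqrtr_sqr; apply: ler_wsqrtr; rewrite expr_div_n ler_pdivrMr//.
  have : 2 * G <= 2 * (sigma p ^+ 2 / (2 * tau p) * `|s| ^+ 2) by lra.
  move=> /le_trans; apply.
  by apply: eq_ler; field; rewrite gt_eqF.
have s1 : 0 < 1 + sigma p by have := sigma_gt0; lra.
rewrite mulrAC ltr_pdivrMr//.
have h1 : eps < (1 + sigma p) * (`|s| / tau p).
  by move: epsU h; rewrite mulrDl mul1r mulrA; lra.
have h2 : (1 - sigma p) * eps < (1 - sigma p) * ((1 + sigma p) * (`|s| / tau p)).
  by rewrite ltr_pM2l//; have := sigma_lt1; lra.
apply: lt_le_trans h2 _.
rewrite mulrCA [leRHS]mulrC ler_pM2l// mulrA mulrC ler_pM2l ?invr_gt0//.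
Qed.

(** * The geometric Cauchy search *)

Section cauchy.
Variables (bmax : R) (w : W) (Delta : R) (B : bounded_linear W W).
Hypotheses (bmax_ge0 : 0 <= bmax) (wdom : edom phi w) (Delta_gt0 : 0 < Delta).
Hypotheses (B_model : model_operator bmax B) (chi_gt0 : 0 < chi w).

Local Notation radius := (cauchy_radius p B).

(** A lower bound for the first radius of the search, uniform in the choice of B. *)
Definition min_radius : R := Num.min (tau p) ((1 - sigma p) / (1 + bmax)).

Lemma min_radius_gt0 : 0 < min_radius.
Proof.
have b1 : 0 < 1 + bmax by have := bmax_ge0; lra.
by rewrite lt_min tau_gt0/= divr_gt0//; have := sigma_lt1; lra.
Qed.

Lemma min_radius_le : min_radius <= radius 0.
Proof.
rewrite /cauchy_radius expr0 mul1r le_min !ge_min lexx/=; apply/orP; right.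
have := opnorm_ge0 B; have := B_model.2 => Bb B0.
rewrite ler_pM2l; last by have := sigma_lt1; lra.
by rewrite lef_pV2 ?posrE; lra.
Qed.

Lemma radius_gt0 j : 0 < radius j.
Proof.
rewrite /cauchy_radius mulr_gt0 ?exprn_gt0// lt_min tau_gt0/= divr_gt0//.
  by have := sigma_lt1; lra.
by have := opnorm_ge0 B; lra.
Qed.

Lemma radius_le0 j : radius j <= radius 0.
Proof.
rewrite /cauchy_radius expr0 ler_wpM2r ?exprn_ile1 ?ltW//.
by have := radius_gt0 0; rewrite /cauchy_radius expr0 mul1r.
Qed.

Lemma radius_le_tau j : radius j <= tau p.
Proof.
apply: le_trans (radius_le0 j) _.
by rewrite /cauchy_radius expr0 mul1r ge_min lexx.
Qed.

Lemma radius_opnorm j : radius j * opnorm B <= 1 - sigma p.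
Proof.
have B0 := opnorm_ge0 B.
have : radius j * (1 + opnorm B) <= 1 - sigma p.
  rewrite -ler_pdivlMr; last by lra.
  apply: le_trans (radius_le0 j) _.
  by rewrite /cauchy_radius expr0 mul1r ge_min lexx orbT.
by have := radius_gt0 j; lra.
Qed.

Definition model_decrease (s : W) : R :=
  linearized w 0 - linearized w s - 2^-1 * ip (B s) s.

Lemma pred_decreaseE s : edom phi (w + s) ->
  pred_decrease T reg f gradf w B s = (model_decrease s)%:E.
Proof.
move=> sdom; rewrite /pred_decrease /model addr0.
rewrite -(phi_fineK reg_proper wdom) -(phi_fineK reg_proper sdom) -!EFinD.
by congr EFin; rewrite /model_decrease /linearized !addr0 linear0 !ip0r; ring.
Qed.

Variable z : nat -> nat -> inner_output W X.
Hypothesis zP : forall j, inner_approximation w (radius j) (z j).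

Let step j := prox_step w (radius j).

Let stepP j : is_prox w (radius j) (step j).
Proof. exact: (prox_stepP reg_proper reg_convex reg_lsc (radius_gt0 j) wdom (zP j)). Qed.

Variable z_tau : nat -> inner_output W X.
Hypothesis z_tauP : inner_approximation w (tau p) z_tau.

Let step_tauP : is_prox w (tau p) (prox_step w (tau p)).
Proof. exact: (prox_stepP reg_proper reg_convex reg_lsc tau_gt0 wdom z_tauP). Qed.

(** The norm of the exact step divided by its radius does not increase with the
    radius, and chi is its value at tau. *)
Lemma chi_le_step j : radius j * chi w <= `|step j|.
Proof.
have [h _] := prox_step_monotone (radius_gt0 j) (radius_le_tau j) (stepP j) step_tauP.
by rewrite /Defs.chi mulrCA ler_pdivrMl.
Qed.

Lemma step_neq0 j : step j != 0.
Proof.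
by rewrite -normr_gt0; apply: lt_le_trans (chi_le_step j); rewrite mulr_gt0 ?radius_gt0.
Qed.

Lemma inner_pass_norm j s : inner_pass p w (radius j) (z j) s ->
  edom phi (w + s) /\
  (1 - sigma p) * `|s| <= `|step j| <= (1 + sigma p) * `|s|.
Proof.
move=> [n [rel _] ->].
have sP := inner_approx_prox reg_proper (radius_gt0 j) wdom (zP j) n.
by split; [exact: sP.1|exact: relative_prox_norm (radius_gt0 j) sigma01 (stepP j) sP rel].
Qed.

(** The cap (1 - sigma) / (1 + |B|) on the radii bounds the curvature term by
    half of the decrease of the linearized model. *)
Lemma inner_pass_decrease j s : inner_pass p w (radius j) (z j) s ->
  (1 - sigma p) / (2 * radius j) * `|s| ^+ 2 <= model_decrease s.
Proof.
move=> [n [rel _] ->].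
have sP := inner_approx_prox reg_proper (radius_gt0 j) wdom (zP j) n.
have := relative_prox_decrease wdom (radius_gt0 j) sigma01 (stepP j) sP rel.
rewrite /model_decrease; set s' := out_y _ - w => h.
have := quadratic_le_opnorm B s'; rewrite ler_norml => /andP[_ q].
have t0 := radius_gt0 j.
have oB : opnorm B <= (1 - sigma p) / radius j.
  by rewrite ler_pdivlMr// mulrC radius_opnorm.
have : opnorm B * `|s'| ^+ 2 <= (1 - sigma p) / radius j * `|s'| ^+ 2.
  by rewrite ler_wpM2r// sqr_ge0.
have -> : (1 - sigma p) / (2 * radius j) * `|s'| ^+ 2 =
  (1 - sigma p) / radius j * `|s'| ^+ 2 / 2 by field; rewrite gt_eqF.
by lra.
Qed.

(** Exact steps vanish with their radii, which makes the search stop: they are at most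
    as long as the step of radius tau, and by the optimality of that step the
    linearized model at them is at least its value there. *)
Lemma step_sqr_le j : `|step j| ^+ 2 <=
  radius j * (linearized w 0 - linearized w (prox_step w (tau p))).
Proof.
have [sdom sP] := stepP j; have [tdom tP] := step_tauP.
have := sP 0; rewrite addr0 ip0r subr0 => /(_ wdom) h1.
have h2 := tP _ sdom.
have [_ h3] := prox_step_monotone (radius_gt0 j) (radius_le_tau j) (stepP j) step_tauP.
have h4 : 0 <= (tau p)^-1 * (`|prox_step w (tau p)| ^+ 2
    - ip (prox_step w (tau p)) (step j)).
  rewrite mulr_ge0 ?invr_ge0 ?(ltW tau_gt0)// subr_ge0; apply: le_trans (ip_le_norm _ _) _.
  by rewrite expr2 ler_wpM2l.
by rewrite -ler_pdivrMl ?radius_gt0//; lra.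
Qed.

Lemma cauchy_search_ex : exists sC, cauchy_search p w Delta B z sC.
Proof.
have /choice[s sP] j : exists s, inner_pass p w (radius j) (z j) s.
  have [n nP] := first_index_ex (relative_test_reached (radius_gt0 j) wdom (zP j) (step_neq0 j)).
  by exists (out_y (z j n) - w), n.
suff /first_index_ex[j jP] : exists j, `|s j| <= Delta by exists (s j), s, j; split.
set K := linearized w 0 - linearized w (prox_step w (tau p)).
have s1 : 0 < 1 - sigma p by have := sigma_lt1; lra.
pose e := ((1 - sigma p) * Delta) ^+ 2.
have e0 : 0 < e by rewrite exprn_gt0// mulr_gt0.
have cv : (fun j => radius j * K) @ \oo --> (0 : R).
  rewrite /cauchy_radius -[0](mul0r K) -[in X in X * K](mul0r (radius 0)).
  apply: cvgM; last exact: cvg_cst.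
  rewrite /cauchy_radius expr0 mul1r; apply: cvgM; last exact: cvg_cst.
  by apply: cvg_expr; rewrite gtr0_norm.
have [j _ jP] := cvgr_lt _ cv _ e0; exists j.
have [_ /andP[ss _]] := inner_pass_norm (sP j).
rewrite -(ler_pM2l s1); apply: le_trans ss _.
rewrite -(@ler_pXn2r _ 2)// ?nnegrE ?mulr_ge0 ?(ltW s1) ?(ltW Delta_gt0)//.
by apply: le_trans (step_sqr_le j) _; apply/ltW/jP; rewrite /= leqnn.
Qed.

(** The factor (1 - sigma) / 2 of the model decrease, times the factors 1 / (1 + sigma)
    and zeta (1 - sigma) / (1 + sigma) of the two lower bounds for |sC|. *)
Definition cauchy_constant : R :=
  zeta p * (1 - sigma p) ^+ 2 / (2 * (1 + sigma p) ^+ 2).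

(** Sufficient decrease.  When the search backtracks, the previous, rejected
    step was longer than Delta, and exact steps shrink at most as fast as their
    radii; so the returned step is at least a fixed fraction of Delta. *)
Lemma cauchy_search_decrease sC : cauchy_search p w Delta B z sC ->
  [/\ `|sC| <= Delta, edom phi (w + sC) &
   cauchy_constant * chi w * Num.min (min_radius * chi w) Delta <=
     model_decrease sC].
Proof.
move=> [s [j [sP [sj jmin] ->]]].
have [sdom /andP[_ hi]] := inner_pass_norm (sP j (leqnn j)).
split=> //; apply: le_trans (inner_pass_decrease (sP j (leqnn j))).
set m := Num.min _ _; set t := radius j.
have t0 : 0 < t := radius_gt0 j.
have s1 : 0 < 1 + sigma p by have := sigma_gt0; lra.
have s1' : 0 < 1 - sigma p by have := sigma_lt1; lra.
have lower1 : t * chi w <= (1 + sigma p) * `|s j| := le_trans (chi_le_step j) hi.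
have m0 : 0 < m by rewrite lt_min Delta_gt0 mulr_gt0 ?min_radius_gt0.
have lower2 : zeta p * (1 - sigma p) * m <= (1 + sigma p) * `|s j|.
  case: j @t {t0 sdom} sP sj jmin hi lower1 => [|i] t sP sj jmin hi lower1.
    apply: le_trans lower1; apply: (@le_trans _ _ m).
      by rewrite -[leRHS]mul1r ler_pM2r// mulr_ile1 ?ltW//; have := sigma_gt0; lra.
    by rewrite ge_min ler_pM2r// min_radius_le.
  have Ds : Delta < `|s i| by rewrite ltNge; apply/negP/jmin.
  have [_ /andP[lo _]] := inner_pass_norm (sP i (leqnSn i)).
  have tE : t = zeta p * radius i by rewrite /t /cauchy_radius exprS mulrA.
  have ti : t <= radius i by rewrite tE ger_pMl ?radius_gt0// ltW.
  have [mono _] := prox_step_monotone (radius_gt0 i.+1) ti (stepP i.+1) (stepP i).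
  have {}mono : zeta p * `|step i| <= `|step i.+1|.
    by move: mono; rewrite -/t tE -mulrA mulrCA ler_pM2l ?radius_gt0.
  apply: le_trans hi; apply: le_trans mono.
  rewrite -mulrA ler_pM2l//; apply: le_trans lo; rewrite ler_pM2l//.
  by rewrite ge_min (ltW Ds) orbT.
have prod : (t * chi w) * (zeta p * (1 - sigma p) * m) <=
   ((1 + sigma p) * `|s j|) * ((1 + sigma p) * `|s j|).
  apply: ler_pM => //; first by rewrite mulr_ge0// ltW.
  by rewrite !mulr_ge0// ltW.
have c0 : 0 < (1 - sigma p) / (2 * t) / (1 + sigma p) ^+ 2.
  by rewrite divr_gt0 ?exprn_gt0// divr_gt0// mulr_gt0.
move: prod; rewrite -(ler_pM2l c0) /cauchy_constant.
set a := (X in X <= _ -> _); set b := (X in _ <= X -> _).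
have -> : a = zeta p * (1 - sigma p) ^+ 2 / (2 * (1 + sigma p) ^+ 2) * chi w * m.
  by rewrite /a; field; rewrite !gt_eqF.
have -> : b = (1 - sigma p) / (2 * t) * `|s j| ^+ 2.
  by rewrite /b; field; rewrite !gt_eqF.
by [].
Qed.

End cauchy.

End iteration.

(** * Outer trials *)

Section trials.
Context {R : realType} {W : hilbertType R} {X : completeNormedModType R}.
Variables (T : bounded_linear W X) (reg : X -> \bar R).
Variables (f : W -> R) (gradf : W -> W) (Lf : R) (p : tr_params R).
Variable inner : W -> R -> (nat -> inner_output W X) -> Prop.
Variables (bmax Dmax : R).
Hypotheses (reg_proper : eproper reg) (reg_convex : econvex reg)
  (reg_lsc : lower_semicontinuous reg) (p_admissible : admissible_params p).
Hypotheses (f_grad : is_gradient f gradf) (Lf_ge0 : 0 <= Lf)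
  (gradf_lip : Lf.-lipschitz gradf).
Hypothesis inner_ok : inner_approximation_property T reg gradf inner.
Hypothesis bmax_ge0 : 0 <= bmax.

Local Notation phi := (phi T reg).
Local Notation chi := (chi T reg gradf (tau p)).
Local Notation outer_trial := (outer_trial T reg f gradf p inner bmax Dmax).
Local Notation model_decrease := (model_decrease T reg gradf).

Let tau_gt0 : 0 < tau p. Proof. by case: p_admissible => [[]]. Qed.
Let sigma_gt0 : 0 < sigma p. Proof. by case: p_admissible => [[_ /andP[]]]. Qed.
Let sigma_lt1 : sigma p < 1. Proof. by case: p_admissible => [[_ /andP[]]]. Qed.
Let zeta_gt0 : 0 < zeta p. Proof. by case: p_admissible => [[_ _ /andP[]]]. Qed.
Let nu_gt0 : 0 < nu p. Proof. by case: p_admissible => [[_ _ _ /andP[]]]. Qed.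
Let nu_le1 : nu p <= 1. Proof. by case: p_admissible => [[_ _ _ /andP[]]]. Qed.
Let eta1_gt0 : 0 < eta1 p. Proof. by case: p_admissible => _ []. Qed.
Let eta12 : eta1 p < eta2 p. Proof. by case: p_admissible => _ []. Qed.
Let eta2_lt1 : eta2 p < 1. Proof. by case: p_admissible => _ []. Qed.
Let gammac_gt0 : 0 < gammac p. Proof. by case: p_admissible => _ [_ _ _ /andP[]]. Qed.
Let gammac_lt1 : gammac p < 1. Proof. by case: p_admissible => _ [_ _ _ /andP[]]. Qed.
Let gammae_gt1 : 1 < gammae p. Proof. by case: p_admissible => _ []. Qed.

(** chi exceeds chi_factor * eps whenever a trial is made. *)
Definition chi_factor : R := (1 - sigma p) / (1 + sigma p).

(** With chi replaced by chi_factor * eps, the sufficient decrease of a trial is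
    decrease_factor * eps * Num.min (radius_factor * eps) Delta. *)
Definition decrease_factor : R := nu p * cauchy_constant p * chi_factor.
Definition radius_factor : R := min_radius p bmax * chi_factor.

(** The summand 1 keeps this bound positive when Lf and bmax vanish. *)
Definition curvature_bound : R := Lf + bmax / 2 + 1.

(** Below radius success_factor * eps the minimum in the decrease is Delta, and the
    model error, of order Delta^2, is at most the fraction 1 - eta2 of that decrease. *)
Definition success_factor : R :=
  Num.min radius_factor (decrease_factor * (1 - eta2 p) / curvature_bound).

Lemma chi_factor_gt0 : 0 < chi_factor.
Proof. by rewrite divr_gt0//; have := sigma_gt0; have := sigma_lt1; lra. Qed.

Lemma cauchy_constant_gt0 : 0 < cauchy_constant p.
Proof.
have s1 : 0 < 1 - sigma p by have := sigma_lt1; lra.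
have s2 : 0 < 1 + sigma p by have := sigma_gt0; lra.
by rewrite /cauchy_constant divr_gt0 ?mulr_gt0 ?exprn_gt0.
Qed.

Lemma decrease_factor_gt0 : 0 < decrease_factor.
Proof.
by rewrite mulr_gt0 ?chi_factor_gt0// mulr_gt0 ?cauchy_constant_gt0.
Qed.

Lemma radius_factor_gt0 : 0 < radius_factor.
Proof. by rewrite mulr_gt0 ?min_radius_gt0 ?chi_factor_gt0. Qed.

Lemma curvature_bound_gt0 : 0 < curvature_bound.
Proof. by rewrite /curvature_bound; move: bmax_ge0 Lf_ge0; lra. Qed.

Lemma success_factor_gt0 : 0 < success_factor.
Proof.
rewrite lt_min radius_factor_gt0/= divr_gt0 ?curvature_bound_gt0//.
by rewrite mulr_gt0 ?decrease_factor_gt0//; have := eta2_lt1; lra.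
Qed.

Definition fobjective (w : W) : R := f w + fine (phi w).

Lemma objectiveE w : edom phi w -> objective T reg f w = (fobjective w)%:E.
Proof. by move=> wdom; rewrite /objective -phi_fineK. Qed.

Lemma model_error w (B : bounded_linear W W) d :
  model_operator bmax B ->
  `|fobjective w - fobjective (w + d) - model_decrease w B d|
     <= (Lf + bmax / 2) * `|d| ^+ 2.
Proof.
move=> [_ Bb]; have := lipschitz_gradient_bound w d Lf_ge0 f_grad gradf_lip.
have : `|ip (B d) d| <= bmax * `|d| ^+ 2.
  by apply: le_trans (quadratic_le_opnorm _ _) _; rewrite ler_wpM2r ?sqr_ge0.
rewrite /fobjective /model_decrease /linearized addr0 ip0r.
rewrite !ler_norml => /andP[h1 h2] /andP[h3 h4]; by apply/andP; split; lra.
Qed.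

(** Failure needs a radius above success_factor * eps, because below it the ratio is
    at least eta2; otherwise the objective decreases by the fraction eta1 of the
    sufficient decrease of the model. *)
Lemma outer_trial_dichotomy (eps : R) w (Delta : R) w' Delta' :
  0 < eps -> edom phi w -> 0 < Delta -> outer_trial eps w Delta w' Delta' ->
  edom phi w' /\
  ([/\ w' = w, Delta' = gammac p * Delta & success_factor * eps < Delta] \/
   [/\ eta1 p * (decrease_factor * eps * Num.min (radius_factor * eps) Delta)
         <= fobjective w - fobjective w',
       Num.min Delta Dmax <= Delta' & Delta' <= gammae p * Delta]).
Proof.
move=> eps0 wdom Delta0 [[zt ztin cert] [B [z [sC [d [BP zin sCP [dD ddom dpred] next]]]]]].
have ztP := (inner_ok wdom tau_gt0).2 _ ztin.
have zP j := (inner_ok wdom (radius_gt0 p_admissible B j)).2 _ (zin j).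
have chi_eps := relative_certificate_chi reg_proper reg_convex reg_lsc p_admissible wdom ztP cert.
rewrite -/chi_factor in chi_eps.
have cf0 := chi_factor_gt0.
have ce0 : 0 < chi_factor * eps by rewrite mulr_gt0.
have chi0 : 0 < chi w by apply: lt_trans chi_eps.
have [sCD sCdom sCdec] := cauchy_search_decrease reg_proper reg_convex reg_lsc
  p_admissible bmax_ge0 wdom Delta0 BP chi0 zP ztP sCP.
set m := Num.min (radius_factor * eps) Delta.
have mr0 := min_radius_gt0 p_admissible bmax_ge0.
have m0 : 0 < m by rewrite lt_min Delta0 mulr_gt0// radius_factor_gt0.
have a0 := decrease_factor_gt0.
have cc0 := cauchy_constant_gt0.
have pred_d : decrease_factor * eps * m <= model_decrease w B d.
  move: dpred; rewrite !(pred_decreaseE f gradf reg_proper B wdom)// -EFinM lee_fin.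
  apply: le_trans.
  have -> : decrease_factor * eps * m =
      nu p * (cauchy_constant p * ((chi_factor * eps) * m)).
    by rewrite /decrease_factor; ring.
  rewrite ler_pM2l//; apply: le_trans sCdec.
  rewrite -[leRHS]mulrA ler_pM2l//.
  apply: ler_pM; rewrite ?(ltW ce0) ?(ltW m0) ?(ltW chi_eps)//.
  rewrite le_min !ge_min lexx orbT andbT; apply/orP; left.
  have -> : radius_factor * eps = min_radius p bmax * (chi_factor * eps).
    by rewrite /radius_factor; ring.
  by rewrite ler_pM2l// ltW.
have pred0 : 0 < model_decrease w B d.
  by apply: lt_le_trans pred_d; rewrite mulr_gt0// mulr_gt0.
move: next; rewrite /next_state.
have -> : Defs.ratio T reg f gradf w B d =
    (fobjective w - fobjective (w + d)) / model_decrease w B d.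
  by rewrite /Defs.ratio (pred_decreaseE f gradf reg_proper B wdom)// !objectiveE.
case: ltP => [rho1 [-> ->]|rho1].
  split=> //; left; split=> //; rewrite ltNge; apply/negP => Dsmall.
  have M0 := curvature_bound_gt0.
  have Dr : Delta <= radius_factor * eps.
    by apply: le_trans Dsmall _; rewrite ler_pM2r// ge_min lexx.
  have mE : m = Delta by rewrite /m; apply/min_idPr.
  have Dc : curvature_bound * Delta <= decrease_factor * (1 - eta2 p) * eps.
    rewrite -ler_pdivlMl//; apply: le_trans Dsmall _; rewrite mulrA.
    by rewrite ler_pM2r// ge_min mulrC lexx orbT.
  have err : curvature_bound * Delta ^+ 2 <= (1 - eta2 p) * model_decrease w B d.
    rewrite expr2 mulrA; apply: (@le_trans _ _ (decrease_factor * (1 - eta2 p) * eps * Delta)).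
      by rewrite ler_pM2r.
    have -> : decrease_factor * (1 - eta2 p) * eps * Delta =
        (1 - eta2 p) * (decrease_factor * eps * m) by rewrite mE; ring.
    by rewrite ler_pM2l//; have := eta2_lt1; lra.
  have dsq : (Lf + bmax / 2) * `|d| ^+ 2 <= curvature_bound * Delta ^+ 2.
    apply: ler_pM; rewrite ?sqr_ge0//.
    - by have := Lf_ge0; have := bmax_ge0; lra.
    - by rewrite /curvature_bound; lra.
    - by rewrite ler_pXn2r ?nnegrE// ltW.
  have := model_error w d BP; rewrite ler_norml => /andP[lo _].
  move: rho1; rewrite ltr_pdivrMr// => rho1.
  have : eta1 p * model_decrease w B d < eta2 p * model_decrease w B d.
    by rewrite ltr_pM2r.
  lra.
have dec : eta1 p * (decrease_factor * eps * m) <= fobjective w - fobjective (w + d).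
  move: rho1; rewrite ler_pdivlMr//; apply: le_trans.
  by rewrite ler_pM2l.
have De : Delta <= gammae p * Delta by rewrite ler_peMl ?(ltW Delta0)// ltW.
case: ltP => _ [-> ->]; (split; [by []|right; split=> //]).
- by rewrite ge_min lexx.
- by rewrite le_min !ge_min De lexx !orbT.
- by rewrite ge_min lexx.
Qed.

(** A relative certificate forces chi to be positive, so every inner run of the search
    stops; and nu <= 1 makes the Cauchy step itself an admissible trial step. *)
Lemma iteration_stopsP (eps : R) w (Delta : R) :
  0 < eps -> edom phi w -> 0 < Delta ->
  iteration_stops T reg f gradf p inner bmax eps w Delta.
Proof.
move=> eps0 wdom Delta0; split=> // [z zin|z zin cert].
  apply: stat_test_stops_ex (eps0) (wdom) _ => //.
  exact: ((inner_ok wdom tau_gt0).2 _ zin).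
have zP := (inner_ok wdom tau_gt0).2 _ zin.
have chi0 : 0 < chi w.
  apply: lt_trans (relative_certificate_chi reg_proper reg_convex reg_lsc
    p_admissible wdom zP cert).
  by rewrite mulr_gt0// chi_factor_gt0.
split=> // B zC BP zCin.
have zCP j := (inner_ok wdom (radius_gt0 p_admissible B j)).2 _ (zCin j).
have [sC sCP] := cauchy_search_ex reg_proper reg_convex reg_lsc p_admissible
  wdom Delta0 chi0 zCP zP.
exists sC => //.
have [sCD sCdom sCdec] := cauchy_search_decrease reg_proper reg_convex reg_lsc
  p_admissible bmax_ge0 wdom Delta0 BP chi0 zCP zP sCP.
split=> //; rewrite (pred_decreaseE f gradf reg_proper B wdom)// -EFinM lee_fin.
rewrite ler_piMl//; apply: le_trans sCdec.
have m0 : 0 <= Num.min (min_radius p bmax * chi w) Delta.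
  by rewrite le_min (ltW Delta0) andbT mulr_ge0 ?(ltW chi0)// ltW// min_radius_gt0.
by rewrite mulr_ge0// mulr_ge0 ?(ltW cauchy_constant_gt0) ?(ltW chi0).
Qed.

(** * Counting the trials *)

Section run.
Variables (w0 : W) (Delta0 Flow : R).
Hypotheses (w0dom : edom phi w0) (Delta0_gt0 : 0 < Delta0) (Delta0_le : Delta0 <= Dmax).
Hypothesis F_low : forall w, edom phi w -> (Flow%:E <= objective T reg f w)%E.
Variables (eps : R) (w : nat -> W) (Delta : nat -> R).
Hypothesis eps01 : 0 < eps <= 1.

Local Notation run n := (run T reg f gradf p inner bmax Dmax w0 Delta0 eps n w Delta).

Let eps_gt0 : 0 < eps. Proof. by case/andP: eps01. Qed.
Let eps_le1 : eps <= 1. Proof. by case/andP: eps01. Qed.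

(** The radii of a run stay above least_radius_factor * eps, as eps <= 1. *)
Definition least_radius_factor : R := Num.min Delta0 (gammac p * success_factor).

Lemma least_radius_factor_gt0 : 0 < least_radius_factor.
Proof. by rewrite lt_min Delta0_gt0 mulr_gt0// success_factor_gt0. Qed.

Lemma run_pred n : run n.+1 -> run n.
Proof. by move=> [h1 h2 h3]; split=> // k kn; apply: h3; exact: ltnW. Qed.

(** The radius shrinks only after a rejected trial, hence only while it exceeds
    success_factor * eps. The other term of the minimum covers the initial radius
    and the cap Dmax, which is at least Delta0. *)
Lemma run_invariant n : run n ->
  edom phi (w n) /\ least_radius_factor * eps <= Delta n.
Proof.
have l0 := least_radius_factor_gt0.
elim: n => [|n IH] rn.
  case: rn => -> -> _; split=> //.
  apply: (@le_trans _ _ least_radius_factor); first by rewrite ler_piMr// ltW.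
  by rewrite ge_min lexx.
have [wdom low] := IH (run_pred rn).
have D0 : 0 < Delta n by apply: lt_le_trans low; rewrite mulr_gt0.
have [_ _ /(_ n (ltnSn n))] := rn.
move=> /(outer_trial_dichotomy eps_gt0 wdom D0)[w'dom [[_ -> big]|[_ low' _]]]; split=> //.
  apply: (@le_trans _ _ (gammac p * (success_factor * eps))).
    by rewrite mulrA ler_pM2r// ge_min lexx orbT.
  by rewrite ler_pM2l// ltW.
apply: le_trans low'; rewrite le_min low/=; apply: le_trans Delta0_le.
apply: (@le_trans _ _ least_radius_factor); first by rewrite ler_piMr// ltW.
by rewrite ge_min lexx.
Qed.

Lemma run_radius_gt0 n : run n -> 0 < Delta n.
Proof.
move=> /run_invariant[_]; apply: lt_le_trans.
by rewrite mulr_gt0// least_radius_factor_gt0.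
Qed.

(** Each accepted trial lowers the objective by at least success_decrease * eps^2. *)
Definition success_decrease : R :=
  eta1 p * (decrease_factor * Num.min radius_factor least_radius_factor).

Lemma success_decrease_gt0 : 0 < success_decrease.
Proof.
rewrite mulr_gt0// mulr_gt0 ?decrease_factor_gt0//.
by rewrite lt_min radius_factor_gt0 least_radius_factor_gt0.
Qed.

Definition log_weight : R := (- ln (gammac p))^-1.

Lemma log_weight_gt0 : 0 < log_weight.
Proof. by rewrite invr_gt0 oppr_gt0 ln_lt0// gammac_gt0. Qed.

(** A rejected trial lowers the logarithm of the radius by the fixed amount
    log_weight^-1; an accepted one raises it by at most ln (gammae p), which is
    paid for by the decrease of the objective.  The weighted sum of the two
    quantities therefore drops by at least one in every trial. *)
Lemma run_potential n : run n ->
  n%:R <= (1 + log_weight * ln (gammae p)) / (success_decrease * eps ^+ 2) *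
      (fobjective w0 - fobjective (w n)) + log_weight * (ln Delta0 - ln (Delta n)).
Proof.
set A := _ / _.
have lw0 := log_weight_gt0.
have sd0 : 0 < success_decrease * eps ^+ 2.
  by rewrite mulr_gt0 ?exprn_gt0// success_decrease_gt0.
elim: n => [|n IH] rn; first by case: rn => -> -> _; rewrite !subrr !mulr0 addr0.
have rn' := run_pred rn; have {}IH := IH rn'.
have [wdom low] := run_invariant rn'; have D0 := run_radius_gt0 rn'.
have D1 := run_radius_gt0 rn.
have [_ _ /(_ n (ltnSn n))] := rn; rewrite -natr1.
move=> /(outer_trial_dichotomy eps_gt0 wdom D0)[w'dom [[-> -> big]|[dec _ up]]].
  rewrite lnM ?posrE//.
  have : log_weight * - ln (gammac p) = 1.
    by rewrite mulVf// gt_eqF// oppr_gt0 ln_lt0// gammac_gt0.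
  by lra.
have lnup : ln (Delta n.+1) <= ln (gammae p) + ln (Delta n).
  by rewrite -lnM ?posrE ?ler_ln ?posrE ?mulr_gt0//; have := gammae_gt1; lra.
have {}dec : success_decrease * eps ^+ 2 <= fobjective (w n) - fobjective (w n.+1).
  apply: le_trans dec.
  have -> : success_decrease * eps ^+ 2 = eta1 p * (decrease_factor * eps *
      (Num.min radius_factor least_radius_factor * eps)).
    by rewrite /success_decrease; ring.
  rewrite ler_pM2l// ler_pM2l; last by rewrite mulr_gt0 ?decrease_factor_gt0.
  rewrite le_min; apply/andP; split; first by rewrite ler_pM2r// ge_min lexx.
  by apply: le_trans low; rewrite ler_pM2r// ge_min lexx orbT.
have lnge : 0 <= ln (gammae p) by rewrite ln_ge0// ltW.
have A0 : 0 < 1 + log_weight * ln (gammae p).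
  by have := mulr_ge0 (ltW lw0) lnge; lra.
have hA : 1 + log_weight * ln (gammae p) <= A * (fobjective (w n) - fobjective (w n.+1)).
  by rewrite /A mulrAC -mulrA ler_peMr ?(ltW A0)// ler_pdivlMr// mul1r.
have hl : log_weight * (ln (Delta n.+1) - ln (Delta n)) <= log_weight * ln (gammae p).
  by rewrite ler_pM2l//; lra.
by lra.
Qed.

Definition complexity_constant : R :=
  (1 + log_weight * ln (gammae p)) / success_decrease * (fobjective w0 - Flow)
  + log_weight * (`|ln Delta0 - ln least_radius_factor| + 1).

Lemma complexity_constant_gt0 : 0 < complexity_constant.
Proof.
have lw0 := log_weight_gt0.
have lnge : 0 <= ln (gammae p) by rewrite ln_ge0// ltW.
have := F_low w0dom; rewrite objectiveE// lee_fin => Fl.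
apply: ltr_wpDl; last by rewrite mulr_gt0// ltr_wpDl.
rewrite mulr_ge0 ?subr_ge0// divr_ge0 ?(ltW success_decrease_gt0)//.
by rewrite addr_ge0// mulr_ge0// ltW.
Qed.

(** In the potential bound the objective is at least Flow and the radius at least
    least_radius_factor * eps; - ln eps is at most eps^-2. *)
Lemma run_length n : run n -> n%:R <= complexity_constant * eps ^- 2.
Proof.
move=> rn; apply: le_trans (run_potential rn) _.
have lw0 := log_weight_gt0; have sd0 := success_decrease_gt0.
have l0 := least_radius_factor_gt0.
have lnge : 0 <= ln (gammae p) by rewrite ln_ge0// ltW.
have [wdom low] := run_invariant rn.
have := F_low wdom; rewrite objectiveE// lee_fin => Fl.
have e20 : 0 < eps ^- 2 by rewrite invr_gt0 exprn_gt0.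
have e21 : 1 <= eps ^- 2 by rewrite invf_ge1 ?exprn_gt0// exprn_ile1 ?(ltW eps_gt0).
rewrite /complexity_constant [leRHS]mulrDl; apply: lerD.
  have -> : (1 + log_weight * ln (gammae p)) / (success_decrease * eps ^+ 2) =
      (1 + log_weight * ln (gammae p)) / success_decrease * eps ^- 2.
    by rewrite invfM mulrA.
  rewrite [leRHS]mulrAC; apply: ler_wpM2l; last by lra.
  by rewrite mulr_ge0 ?(ltW e20)// divr_ge0 ?(ltW sd0)// addr_ge0// mulr_ge0// ltW.
rewrite -[leRHS]mulrA ler_pM2l//.
have ln1 : - ln eps <= eps ^- 2.
  have ei0 : 0 < eps^-1 by rewrite invr_gt0.
  rewrite -lnV ?posrE//; apply: (@le_trans _ _ (eps^-1)).
    have -> : eps^-1 = 1 + (eps^-1 - 1) :> R by ring.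
    by apply: le_trans (le_ln1Dx _) _; lra.
  rewrite -exprVn expr2 ler_peMr ?(ltW ei0)// invf_ge1//.
have ln2 : ln least_radius_factor + ln eps <= ln (Delta n).
  by rewrite -lnM ?posrE// ler_ln ?posrE ?mulr_gt0// (lt_le_trans _ low)// mulr_gt0.
have := ler_norm (ln Delta0 - ln least_radius_factor).
have : `|ln Delta0 - ln least_radius_factor| <=
   `|ln Delta0 - ln least_radius_factor| * eps ^- 2 by rewrite ler_peMr.
by lra.
Qed.

End run.

End trials.

(** * Termination and complexity *)

Theorem theorem4p7 (R : realType) (W : hilbertType R)
    (X : completeNormedModType R) (T : bounded_linear W X)
    (reg : X -> \bar R) (f : W -> R) (gradf : W -> W) (Lf Flow : R)
    (p : tr_params R)
    (inner : W -> R -> (nat -> inner_output W X) -> Prop)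
    (w0 : W) (Delta0 Dmax bmax : R) :
  eproper reg -> econvex reg -> lower_semicontinuous reg ->
  edom (phi T reg) !=set0 ->
  is_gradient f gradf -> continuous gradf ->
  0 <= Lf -> Lf.-lipschitz gradf ->
  (forall w, edom (phi T reg) w -> (Flow%:E <= objective T reg f w)%E) ->
  admissible_params p ->
  inner_approximation_property T reg gradf inner ->
  edom (phi T reg) w0 ->
  0 < Delta0 -> Delta0 <= Dmax -> 0 <= bmax ->
  (forall eps : R, 0 < eps <= 1 ->
     terminates_finitely T reg f gradf p inner bmax Dmax w0 Delta0 eps /\
     forall n w Delta,
       run T reg f gradf p inner bmax Dmax w0 Delta0 eps n w Delta ->
       returns p inner eps (w n) -> chi T reg gradf (tau p) (w n) <= eps) /\
  (exists C eps0 : R, [/\ 0 < C, 0 < eps0 <= 1 &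
     forall eps : R, 0 < eps <= eps0 ->
     forall n w Delta,
       run T reg f gradf p inner bmax Dmax w0 Delta0 eps n w Delta ->
       n%:R <= C * eps ^- 2]).
Proof.
move=> regp regc regl _ fg _ Lf0 gl Fl padm inn w0d D0 D0l b0.
have len eps n w Delta := @run_length _ _ _ T reg f gradf Lf p inner bmax Dmax
  regp regc regl padm fg Lf0 gl inn b0 w0 Delta0 Flow w0d D0 D0l Fl eps w Delta ^~ n.
have tau0 : 0 < tau p by case: padm => [[]].
split.
  move=> eps eps01; have eps0 : 0 < eps by case/andP: eps01.
  have inv n w Delta := @run_invariant _ _ _ T reg f gradf Lf p inner bmax Dmax
    regp regc regl padm fg Lf0 gl inn b0 w0 Delta0 w0d D0 D0l eps w Delta eps01 n.
  split; last first.
    move=> n w Delta /inv[wdom _] [z zin [j _ zj]].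
    apply: le_trans zj; apply: chi_le_stat_bound => //.
    exact: ((inn _ _ wdom tau0).2 _ zin).
  split=> [n w Delta rn|[w [Delta rn]]].
    have [wdom low] := inv _ _ _ rn.
    apply: iteration_stopsP => //; apply: lt_le_trans low.
    by rewrite mulr_gt0// least_radius_factor_gt0.
  have K0 := len _ _ _ _ eps01 (rn 0%N).
  have := len _ _ _ _ eps01 (rn (Num.bound
    (complexity_constant T reg f Lf p bmax w0 Delta0 Flow / eps ^+ 2))).
  by apply/negP; rewrite -ltNge; exact: archi_boundP (le_trans (ler0n _ _) K0).
exists (complexity_constant T reg f Lf p bmax w0 Delta0 Flow), 1; split.
- exact: complexity_constant_gt0.
- by rewrite ltr01 lexx.
by move=> eps eps01 n w Delta; apply: len.
Qed.
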